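(* Let $\nu$ be an instance with $\mu_1\ge\dots\ge\mu_L$, $\mu_1>\mu_L$, fix $T$, $T_{\mathrm{FE}}>0$, $\alpha,\beta\in(0,1)$, and let $\bar\Delta:=\mathrm{Save}^*(\nu,T_{\mathrm{FE}})/T_{\mathrm{FE}}$. Let $\mathcal{L}_{\mathrm g}:=\{i\in[L]:\Delta_i<\bar\Delta-\frac{1-\alpha}{\alpha}\Delta_L\}$ and assume $\mathcal{L}_{\mathrm g}\neq\emptyset$. For $\xi_1>0$ let $\nu^{(1)}$ be the instance in which arms $i\in\mathcal{L}_{\mathrm g}$ have mean $\frac{\mu_1+\mu_L-\xi_1}{2}$ and all other arms have mean $\frac{\mu_1+\mu_L+\xi_1}{2}$, and assume $|\mathcal{L}_{\mathrm g}|\ln T/D_{\mathrm{kl}}(\nu^{(1)}_{\mathrm{low}},\nu^{(1)}_{\mathrm{high}})>T_{\mathrm{FE}}$, where $\nu^{(1)}_{\mathrm{low}},\nu^{(1)}_{\mathrm{high}}$ are the two distributions used in $\nu^{(1)}$ (lower and higher mean). If $\pi$ is $(\alpha,\beta)$-probably saving on $\{\nu,\nu^{(1)}\}$, then $$T_{\mathrm{FE}}\ge\frac{\beta\ln T}{\max_{i\in[L]}D_{\mathrm{kl}}(\nu_i,\nu^{(1)}_i)}.$$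
   Context: All arm distributions belong to a fixed single-parameter exponential family on $[0,1]$ parametrized by the mean; $\Delta_i=\mu_1-\mu_i$. A policy picks arm $i_t$ at each round based on the past; $T_{i,t}$ is the number of pulls of arm $i$ in rounds $1..t$. For any instance $\nu'$ with best arm $i^*$ and gaps $\Delta'_i=\mu'_{i^*}-\mu'_i$, let $c'_i=\ln T/D_{\mathrm{kl}}(\nu'_i,\nu'_{i^*})$ ($+\infty$ if the divergence is $0$); $\widehat{\mathrm{Save}}(\pi;\nu',T_{\mathrm{FE}})=\sum_{i:\Delta'_i>0}\Delta'_i\min\{T_{i,T_{\mathrm{FE}}},c'_i\}$; after relabeling arms in nonincreasing order of means, $i_{\mathrm{FE}}=\max\{j:\sum_{i\ge j}c'_i\ge T_{\mathrm{FE}}\}$ and $\mathrm{Save}^*(\nu',T_{\mathrm{FE}})=\Delta'_{i_{\mathrm{FE}}}(T_{\mathrm{FE}}-\sum_{i>i_{\mathrm{FE}}}c'_i)+\sum_{i>i_{\mathrm{FE}}}\Delta'_ic'_i$. A policy $\pi$ is $(\alpha,\beta)$-probably saving on a set $S$ of instances (at horizon $T$ with budget $T_{\mathrm{FE}}$) if for every $\nu'\in S$, $\mathbb{P}_{\nu'}\big(\widehat{\mathrm{Save}}(\pi;\nu',T_{\mathrm{FE}})\ge\alpha\,\mathrm{Save}^*(\nu',T_{\mathrm{FE}})\big)\ge1-T^{-\beta}/2.4$. *)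

(* Defs.v *)
From HB Require Import structures.
From mathcomp Require Import all_boot all_order all_algebra.
From mathcomp Require Import all_classical all_reals all_analysis.
Set Implicit Arguments. Unset Strict Implicit. Unset Printing Implicit Defensive.
Import Order.TTheory GRing.Theory Num.Theory.
Import numFieldNormedType.Exports.
Local Open Scope classical_set_scope.
Local Open Scope ring_scope.

(* Members are identified by their mean (mean is injective).                 *)
Section ExpFam.
Variable R : realType.
Variable rho : {measure set R -> \bar R}.

Definition expfam_base : Prop :=
  [/\ rho (~` [set x : R | 0 <= x <= 1]) = 0%E,
      (rho setT < +oo)%E &
      ~ (exists a : R, rho (~` [set a]) = 0%E)].

Definition ef_Z (th : R) : R := fine (\int[rho]_x (expR (th * x))%:E)%E.
Definition ef_dens (th : R) (x : R) : R := expR (th * x) / ef_Z th.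
Definition ef_mean (th : R) : R := fine (\int[rho]_x (x * ef_dens th x)%:E)%E.
Definition ef_kl (th th' : R) : R :=
  fine (\int[rho]_x (ef_dens th x * ln (ef_dens th x / ef_dens th' x))%:E)%E.

(* Instances with L = n.+1 arms, given by the natural parameters of arms.    *)
Variable n : nat.
Notation Arm := 'I_n.+1.

Section Instance.
Variable th : Arm -> R.
Variables (T TFE : nat).

Definition inst_mean (i : Arm) : R := ef_mean (th i).
Definition best_arm : Arm := (Order.arg_max ord0 xpredT inst_mean).
Definition gap (i : Arm) : R := inst_mean best_arm - inst_mean i.
Definition cc (i : Arm) : \bar R :=
  if ef_kl (th i) (th best_arm) == 0 then +oo%E
  else (ln (T%:R) / ef_kl (th i) (th best_arm))%:E.

Definition save_hat (cnt : Arm -> nat) : \bar R :=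
  (\sum_(i | (0 < gap i)%R) (gap i)%:E * mine (cnt i)%:R%:E (cc i))%E.

Definition sorted_arms : seq Arm :=
  sort (fun i j => inst_mean j <= inst_mean i) (enum Arm).
Definition arm_at (p : nat) : Arm := nth ord0 sorted_arms p.
Definition tail_c (k : nat) : \bar R := (\sum_(k <= p < n.+1) cc (arm_at p))%E.
(* i_FE (0-indexed position) *)
Definition iFE : nat := \max_(k < n.+1 | (TFE%:R%:E <= tail_c k)%E) k.
Definition save_star : \bar R :=
  ((gap (arm_at iFE))%:E * (TFE%:R%:E - \sum_(iFE.+1 <= p < n.+1) cc (arm_at p))
   + \sum_(iFE.+1 <= p < n.+1) (gap (arm_at p))%:E * cc (arm_at p))%E.
End Instance.

(* Bandit interaction (stack-of-rewards model).                              *)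
(* A policy is pi u h : Arm, where u is the policy's internal randomization   *)
(* and h the sequence of rewards observed so far (the past arms are          *)
(* determined by u and h).  X i s is the s-th reward of arm i.               *)
Section Interaction.
Variable pi : R -> seq R -> Arm.
Variable u : R.
Variable X : Arm -> nat -> R.

Fixpoint history (t : nat) : seq (Arm * R) :=
  match t with
  | 0 => [::]
  | t'.+1 => let h := history t' in
             let a := pi u (map snd h) in
             rcons h (a, X a (count (fun q => q.1 == a) h))
  end.
Definition pulls (i : Arm) (t : nat) : nat :=
  count (fun q => q.1 == i) (history t).
End Interaction.

Definition policy_measurable (pi : R -> seq R -> Arm) : Prop :=
  forall (t : nat) (i : Arm),
    measurable [set p : R * t.-tuple R | pi p.1 (tval p.2) = i].

Section Model.
Context d (Omega : measurableType d).

Definition mutually_independent (P : probability Omega R) (K : eqType)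
    (Z : K -> Omega -> R) : Prop :=
  forall (s : seq K) (B : K -> set R), uniq s -> (forall k, measurable (B k)) ->
    P (\bigcap_(k in [set` s]) (Z k @^-1` B k)) =
    (\prod_(k <- s) P (Z k @^-1` B k))%E.

Definition stack_var (U : Omega -> R) (X : Arm -> nat -> Omega -> R)
    (k : option (Arm * nat)) : Omega -> R :=
  match k with None => U | Some (i, s) => X i s end.

Definition bandit_model (P : probability Omega R) (th : Arm -> R)
    (U : Omega -> R) (X : Arm -> nat -> Omega -> R) : Prop :=
  [/\ measurable_fun setT U,
      (forall i s, measurable_fun setT (X i s)),
      mutually_independent P (stack_var U X) &
      (forall i s (A : set R), measurable A ->
         P (X i s @^-1` A) = (\int[rho]_(x in A) (ef_dens (th i) x)%:E)%E)].

Definition saving_event (pi : R -> seq R -> Arm) (U : Omega -> R)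
    (X : Arm -> nat -> Omega -> R) (th : Arm -> R) (T TFE : nat) (alpha : R)
    : set Omega :=
  [set w | (alpha%:E * save_star th T TFE <=
            save_hat th T (fun i => pulls pi (U w) (fun j s => X j s w) i TFE))%E].

Definition probably_saving_at (pi : R -> seq R -> Arm) (U : Omega -> R)
    (X : Arm -> nat -> Omega -> R) (P : probability Omega R) (th : Arm -> R)
    (T TFE : nat) (alpha beta : R) : Prop :=
  ((1 - (T%:R `^ (- beta)) / (24%:R / 10%:R))%:E <=
     P (saving_event pi U X th T TFE alpha))%E.
End Model.

End ExpFam.

(* Main.v *)
(** Let G be the number of pulls, within the budget TFE, of the arms of Lg.
    Saving an alpha fraction of Save* on nu forces G < alpha TFE, whereas on
    nu^(1), where only the arms of Lg carry a gap and Save* = xi1 TFE, it forces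
    G >= alpha TFE.  With x = T^(-beta)/2.4, the event G < alpha TFE thus has
    probability at least 1 - x under nu and at most x under nu^(1).
    The law of the observations (U, rewards) under nu has Kullback-Leibler
    divergence at most TFE * max_i kl(nu_i, nu^(1)_i) from its law under nu^(1).
    This enters in Donsker-Varadhan form, E_P phi <= KL + ln E_Q exp phi, proved
    by induction on the horizon from the one-arm inequality, so that no likelihood
    ratio of the whole history is needed.  A multiple of the indicator of the event
    as phi gives kl(1 - x, x) <= TFE * max_i kl(nu_i, nu^(1)_i), and
    kl(1 - x, x) >= ln (1 / (2.4 x)) = beta ln T. *)

Require Import Defs.
From HB Require Import structures.
From mathcomp Require Import all_boot all_order all_algebra.
From mathcomp Require Import all_classical all_reals all_analysis.
From mathcomp Require Import measurable_realfun.
From mathcomp Require Import ring lra.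
Import Order.TTheory GRing.Theory Num.Theory.
Local Open Scope classical_set_scope.
Local Open Scope ring_scope.

(** * Integration against independent pairs and against densities *)

Section Independence.
Local Open Scope ereal_scope.
Context {R : realType} {d d1 d2 : measure_display} {Omega : measurableType d}
  {T1 : measurableType d1} {T2 : measurableType d2}.

(** The hypothesis on rectangles identifies the joint law of [Y] and [Z] with the product of the law
    of [Y] and [p]; Tonelli then integrates out [Z]. *)
Lemma integral_indep_fubini (P : probability Omega R) (p : probability T2 R)
    (Y : Omega -> T1) (Z : Omega -> T2) (F : T1 * T2 -> \bar R) :
  measurable_fun setT Y -> measurable_fun setT Z ->
  (forall A B, measurable A -> measurable B ->
     P (Y @^-1` A `&` Z @^-1` B) = P (Y @^-1` A) * p B) ->
  measurable_fun setT F -> (forall z, 0 <= F z) ->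
  \int[P]_w F (Y w, Z w) = \int[P]_w \int[p]_z F (Y w, z).
Proof.
move=> mY mZ YZ mF F0.
pose mYm := isMeasurableFun.Build _ _ _ _ _ mY.
pose Ym : {mfun Omega >-> T1} := HB.pack Y mYm.
pose PY : probability T1 R := distribution P Ym.
have mYZ : measurable_fun setT (fun w => (Y w, Z w)) by exact: measurable_fun_pair.
pose mYZm := isMeasurableFun.Build _ _ _ _ _ mYZ.
pose YZm : {mfun Omega >-> (T1 * T2)%type} := HB.pack (fun w => (Y w, Z w)) mYZm.
transitivity (\int[distribution P YZm]_z F z).
  by rewrite ge0_integral_distribution.
transitivity (\int[(PY \x p)]_z F z).
  apply: eq_measure_integral => A mA _; apply/esym.
  by apply: product_measure_unique => // B C mB mC; exact: YZ.
rewrite fubini_tonelli1// /PY /fubini_F ge0_integral_distribution//.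
- exact: measurable_fun_fubini_tonelli_F.
- by move=> y; apply: integral_ge0.
Qed.

End Independence.

Section Density.
Local Open Scope ereal_scope.
Import HBNNSimple.
Context {R : realType} {d : measure_display} {T : measurableType d}.

(** The hypothesis on [nu] is the case of indicators; linearity gives the simple approximations
    [h n] of [f], and monotone convergence gives [f]. *)
Lemma ge0_integral_density (mu nu : {measure set T -> \bar R})
    (g : T -> R) (f : T -> \bar R) :
  measurable_fun setT g -> (forall x, (0 <= g x)%R) ->
  (forall A, measurable A -> nu A = \int[mu]_(x in A) (g x)%:E) ->
  measurable_fun setT f -> (forall x, 0 <= f x) ->
  \int[nu]_x f x = \int[mu]_x (f x * (g x)%:E).
Proof.
move=> mg g0 nuE mf f0; have {}mg : measurable_fun setT (fun x => (g x)%:E) by exact/measurable_EFinP.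
have g0' x : 0 <= (g x)%:E by rewrite lee_fin.
pose h := nnsfun_approx measurableT mf.
have mh n : measurable_fun setT (fun x => (h n x)%:E).
  by apply/measurable_EFinP/measurable_funP.
have fE x : f x = limn (fun n => (h n x)%:E).
  by apply/esym/cvg_lim => //; apply: cvg_nnsfun_approx.
have hnd x : nondecreasing_seq (fun n => (h n x)%:E).
  by move=> a b ab; rewrite lee_fin; exact/lefP/nd_nnsfun_approx.
transitivity (limn (fun n => \int[nu]_x (h n x)%:E)).
  rewrite -monotone_convergence//; first by apply: eq_integral => x _; rewrite fE.
  by move=> n x _; rewrite lee_fin.
transitivity (limn (fun n => \int[mu]_x ((h n x)%:E * (g x)%:E))); last first.
  rewrite -monotone_convergence//.
  - apply: eq_integral => x _; apply/cvg_lim => //.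
    by rewrite fE; apply: cvgeZr => //; apply: ereal_nondecreasing_is_cvgn.
  - by move=> n; apply: emeasurable_funM.
  - by move=> n x _; rewrite mule_ge0// lee_fin.
  - by move=> x _ a b ab; rewrite lee_wpmul2r//; apply: hnd.
congr (limn _); apply/funext => n.
under eq_integral do rewrite fimfunE -fsumEFin//.
rewrite ge0_integral_fsum//; last 2 first.
- by move=> y; exact/measurable_EFinP/measurable_funM.
- by move=> y x _; rewrite nnfun_muleindic_ge0.
transitivity (\int[mu]_x (\sum_(y \in range (h n))
    ((y * \1_(h n @^-1` [set y]) x)%:E * (g x)%:E))); last first.
  apply: eq_integral => x _.
  rewrite -ge0_mule_fsuml => [|y]; last exact: nnfun_muleindic_ge0.
  by rewrite fsumEFin// -fimfunE.
rewrite ge0_integral_fsum//; last 2 first.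
- by move=> y; apply: emeasurable_funM => //; exact/measurable_EFinP/measurable_funM.
- by move=> y x _; rewrite mule_ge0// nnfun_muleindic_ge0.
apply: eq_fsbigr => r rhn.
have r0 : (0 <= r)%R by move: rhn; rewrite inE => -[t _ <-].
rewrite integralZl_indic_nnsfun// integral_indic// setIT nuE//.
under [RHS]eq_integral do rewrite EFinM -muleA.
rewrite ge0_integralZl//.
- congr (_ * _); under [RHS]eq_integral do rewrite muleC.
  rewrite integral_mkcond; apply: eq_integral => x _.
  by rewrite epatch_indic.
- by apply: emeasurable_funM => //; exact/measurable_EFinP.
- by move=> x _; rewrite mule_ge0// lee_fin.
Qed.

End Density.

(** * Events that do not depend on one coordinate *)

Section Cylinders.
Context {R : realType} {d : measure_display} {Omega : measurableType d}
  {K : choiceType}.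
Variable Z : K -> Omega -> R.

(** A pi-system generating the sigma-algebra of all coordinates other than [k0]. Its closure under
    intersection is what uniqueness of measures requires. *)
Definition cylinders_without (k0 : K) : set (set Omega) :=
  [set A | exists (s : seq K) (B : K -> set R),
     [/\ uniq s, k0 \notin s, forall k, measurable (B k) &
         A = \bigcap_(k in [set` s]) (Z k @^-1` B k)]].

Hypothesis mZ : forall k, measurable_fun setT (Z k).

Lemma cylinders_without_measurable k0 : cylinders_without k0 `<=` measurable.
Proof.
move=> _ [s [B [_ _ mB ->]]]; rewrite bigcap_seq.
apply: bigsetI_measurable => k _.
by rewrite -[X in measurable X]setTI; apply: mZ.
Qed.

Lemma cylinders_without_setI k0 : setI_closed (cylinders_without k0).
Proof.
move=> _ _ [s1 [B1 [u1 k1 mB1 ->]]] [s2 [B2 [u2 k2 mB2 ->]]].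
exists (undup (s1 ++ s2)),
  (fun k => (if k \in s1 then B1 k else setT) `&` (if k \in s2 then B2 k else setT)).
split.
- exact: undup_uniq.
- by rewrite mem_undup mem_cat negb_or k1.
- by move=> k; apply: measurableI; case: ifP.
- apply/seteqP; split=> w /=.
    move=> [h1 h2] k /=; rewrite mem_undup mem_cat => ks; split.
      by case: ifPn => // k1s; exact: h1.
    by case: ifPn => // k2s; exact: h2.
  move=> h; split=> k /= ks.
    by have := h k; rewrite /= mem_undup mem_cat ks => /(_ isT)[].
  by have := h k; rewrite /= mem_undup mem_cat ks orbT => /(_ isT)[].
Qed.

Lemma cylinders_without_setT k0 : cylinders_without k0 setT.
Proof.
exists [::], (fun=> setT); split => //.
by rewrite set_nil bigcap_set0.
Qed.

Lemma cylinders_withoutP k0 k (B : set R) : k != k0 -> measurable B ->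
  cylinders_without k0 (Z k @^-1` B).
Proof.
move=> kk0 mB; exists [:: k], (fun=> B); split => //.
- by rewrite inE eq_sym.
- by rewrite set_cons1 bigcap_set1.
Qed.

Local Open Scope ereal_scope.
Variable P : probability Omega R.
Hypothesis indep : mutually_independent P Z.

(** As functions of [A], both sides are finite measures. They agree on the cylinders by mutual
    independence, hence on the generated sigma-algebra. *)
Lemma cylinders_without_indep k0 (A : set Omega) (B : set R) :
  <<s cylinders_without k0 >> A -> measurable B ->
  P (A `&` Z k0 @^-1` B) = P A * P (Z k0 @^-1` B).
Proof.
move=> sA mB.
have mZB : measurable (Z k0 @^-1` B) by rewrite -[X in measurable X]setTI; apply: mZ.
have cN : (0 <= fine (P (Z k0 @^-1` B)))%R by rewrite fine_ge0.
have cE C : mscale (NngNum cN) P C = P C * P (Z k0 @^-1` B).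
  by rewrite [LHS]/mscale /= fineK ?fin_num_measure// muleC.
rewrite -cE; apply: (@g_sigma_algebra_measure_unique _ R _ (cylinders_without k0)
  (@cylinders_without_measurable k0) (fun=> setT)
  (fun=> cylinders_without_setT k0) _ (mrestr P mZB) (mscale (NngNum cN) P)
  (@cylinders_without_setI k0) _ _ A sA).
- by rewrite -subTset => w _; exists 0%N.
- move=> _ [s [C [us k0s mC ->]]]; apply: etrans (esym (cE _)) => /=.
  rewrite /mrestr.
  (* Adding the constraint [B] at [k0] turns the intersection into a single cylinder over [k0 :: s],
     to which mutual independence applies. *)
  pose C' k := if k == k0 then B else C k.
  have C'E k : k \in s -> C' k = C k.
    by rewrite /C' => ks; case: eqP => // kk0; rewrite -kk0 ks in k0s.
  have C'0 : C' k0 = B by rewrite /C' eqxx.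
  have mC' k : measurable (C' k) by rewrite /C'; case: ifP.
  have us' : uniq (k0 :: s) by rewrite /= k0s us.
  have capE : \bigcap_(k in [set` k0 :: s]) Z k @^-1` C' k =
      \bigcap_(k in [set` s]) Z k @^-1` C k `&` Z k0 @^-1` B.
    apply/seteqP; split=> w /=.
      move=> h; split=> [k /= ks|].
        by have := h k; rewrite /= inE ks orbT C'E// => /(_ isT).
      by have := h k0; rewrite /= inE eqxx C'0 => /(_ isT).
    move=> [h hB] k /=; rewrite inE => /orP[/eqP ->|ks]; first by rewrite C'0.
    by rewrite C'E//; exact: h.
  rewrite -capE (indep _ _ us' mC') (indep _ _ us mC) big_cons C'0 muleC; congr (_ * _).
  by rewrite big_seq [RHS]big_seq; apply: eq_bigr => k /C'E <-.
- by move=> _; rewrite /= /mrestr setTI ltey_eq fin_num_measure.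
Qed.

End Cylinders.

(** * The history as a measurable function of the reward stacks *)

Section History.
Context {R : realType} {n : nat}.
Variable pi : R -> seq R -> 'I_n.+1.
Implicit Types (u : R) (X : 'I_n.+1 -> nat -> R) (i : 'I_n.+1).

Lemma size_history u X t : size (map snd (history pi u X t)) == t.
Proof. by rewrite size_map; elim: t => //= t IH; rewrite size_rcons eqSS. Qed.

(** The length is put into the type so that the rewards live in a measurable space, the one in which
    [policy_measurable] is stated. *)
Definition rewards u X t : t.-tuple R := Tuple (size_history u X t).

Definition next_arm u X t : 'I_n.+1 := pi u (rewards u X t).

Lemma rewardsS u X t : rewards u X t.+1 =
  [tuple of rcons (rewards u X t) (X (next_arm u X t) (pulls pi u X (next_arm u X t) t))].
Proof. by apply: val_inj => /=; rewrite map_rcons. Qed.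

Lemma pullsS u X i t :
  pulls pi u X i t.+1 = (pulls pi u X i t + (next_arm u X t == i))%N.
Proof. by rewrite /pulls /= -cats1 count_cat /= addn0. Qed.

Lemma leq_pulls u X i t : (pulls pi u X i t <= t)%N.
Proof.
elim: t => // t IH; rewrite pullsS -(addn1 t) leq_add//.
by case: eqP.
Qed.

(* The s-th reward of arm i only enters the history once arm i has been pulled
   s + 1 times. *)
Lemma eq_history u X X' i s t :
  (forall j r, (j, r) != (i, s) -> X j r = X' j r) ->
  (pulls pi u X i t <= s)%N -> history pi u X t = history pi u X' t.
Proof.
move=> XX'; elim: t => // t IH; rewrite pullsS => ts.
have {}IH : history pi u X t = history pi u X' t.
  by apply: IH; apply: leq_trans ts; exact: leq_addr.
rewrite /= -IH; congr (rcons _ (_, _)).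
apply: XX'; apply/eqP => -[ai cs]; move: ts.
by rewrite -[next_arm u X t]/(pi u _) ai eqxx addn1 -{1}ai -cs ai ltnn.
Qed.

Lemma eq_history_pulls u X X' i s t :
  (forall j r, (j, r) != (i, s) -> X j r = X' j r) ->
  (pulls pi u X i t == s) = (pulls pi u X' i t == s).
Proof.
move=> XX'; apply/eqP/eqP => ps.
  by rewrite -ps /pulls (@eq_history u X X' i s)// ps.
by rewrite -ps /pulls -(@eq_history u X' X i s)// => [j r /XX' //|]; rewrite ps.
Qed.

End History.

Section MeasurableHistory.
Context {R : realType} {n : nat} {d : measure_display} {Omega : measurableType d}.
Variable pi : R -> seq R -> 'I_n.+1.
Hypothesis Hpi : policy_measurable pi.

Lemma measurable_rcons (t : nat) (f : Omega -> t.-tuple R) (g : Omega -> R) :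
  measurable_fun setT f -> measurable_fun setT g ->
  measurable_fun setT (fun w => [tuple of rcons (f w) (g w)]).
Proof.
move=> mf mg; apply/measurable_fun_tnthP => i.
have [it|ti] := ltnP i t.
  rewrite (_ : _ \o _ = (@tnth t R ^~ (Ordinal it)) \o f).
    by apply: measurableT_comp => //; exact: measurable_tnth.
  by apply/funext => w /=; rewrite !(tnth_nth 0) /= nth_rcons size_tuple it.
rewrite (_ : _ \o _ = g)//; apply/funext => w /=.
have it : i = t :> nat by apply/eqP; rewrite eqn_leq ti -ltnS ltn_ord.
by rewrite (tnth_nth 0) /= nth_rcons size_tuple it ltnn eqxx.
Qed.

Variables (U : Omega -> R) (X : 'I_n.+1 -> nat -> Omega -> R).
Hypotheses (mU : measurable_fun setT U) (mX : forall i s, measurable_fun setT (X i s)).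

Local Notation Xw w := (fun i s => X i s w).

Lemma measurable_policy_preimage t (f : Omega -> t.-tuple R) i :
  measurable_fun setT f -> measurable [set w | pi (U w) (f w) = i].
Proof.
move=> mf; rewrite -[X in measurable X]setTI.
have mUf : measurable_fun setT (fun w => (U w, f w)) by exact: measurable_fun_pair.
exact: mUf (Hpi t i).
Qed.

(** Rewards and counts need a joint induction: the next reward is a stack entry at random indices,
    and its measurability is obtained by splitting over the countably many values of the chosen arm
    and of its count. *)
Lemma measurable_history t :
  measurable_fun setT (fun w => rewards pi (U w) (Xw w) t) /\
  forall i s, measurable [set w | pulls pi (U w) (Xw w) i t = s].
Proof.
elim: t => [|t [IHr IHp]].
  split=> [|i s]; first by apply/measurable_fun_tnthP => -[].
  have [->|s0] := eqVneq s 0%N.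
    by rewrite (_ : mkset _ = setT)//; apply/seteqP.
  by rewrite (_ : mkset _ = set0)//; apply/seteqP; split=> w //= /esym/eqP; rewrite (negbTE s0).
have ma i := measurable_policy_preimage t _ i IHr.
split; last first.
  move=> i s.
  rewrite (_ : mkset _ =
    ([set w | next_arm pi (U w) (Xw w) t = i] `&`
      [set w | (pulls pi (U w) (Xw w) i t).+1 = s]) `|`
    ((~` [set w | next_arm pi (U w) (Xw w) t = i]) `&`
      [set w | pulls pi (U w) (Xw w) i t = s])).
    apply: measurableU; apply: measurableI; first exact: ma.
    - case: s => [|s]; first by rewrite (_ : mkset _ = set0)//; apply/seteqP; split.
      rewrite (_ : mkset _ = [set w | pulls pi (U w) (Xw w) i t = s]); first exact: IHp.
      by apply/seteqP; split=> w /= => [[]|->].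
    - exact/measurableC/ma.
    - exact: IHp.
  apply/seteqP; split=> w /=; rewrite pullsS.
    by case: eqP => ai; rewrite ?addn1 ?addn0 => ps; [left|right].
  by move=> [[-> <-]|[/eqP/negbTE -> <-]]; rewrite ?eqxx ?addn1 ?addn0.
rewrite (_ : (fun w => _) = fun w => [tuple of rcons (rewards pi (U w) (Xw w) t)
    (X (next_arm pi (U w) (Xw w) t) (pulls pi (U w) (Xw w) (next_arm pi (U w) (Xw w) t) t) w)]).
  apply: measurable_rcons => // _ B mB; rewrite setTI.
  rewrite (_ : _ @^-1` B = \bigcup_s \big[setU/set0]_(i < n.+1)
     ([set w | next_arm pi (U w) (Xw w) t = i] `&`
      [set w | pulls pi (U w) (Xw w) i t = s] `&` X i s @^-1` B)).
    apply: bigcupT_measurable => s; apply: bigsetU_measurable => i _.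
    apply: measurableI; first exact: measurableI.
    by rewrite -[X in measurable X]setTI; apply: mX.
  apply/seteqP; split=> w /=.
    move=> Bw; exists (pulls pi (U w) (Xw w) (next_arm pi (U w) (Xw w) t) t) => //.
    by rewrite -bigcup_mkord_ord; exists (next_arm pi (U w) (Xw w) t) => //=; rewrite inord_val.
  move=> [s _]; rewrite -bigcup_mkord_ord => -[i /= _ [[<- <-]]].
  by [].
by apply/funext => w; rewrite rewardsS.
Qed.

End MeasurableHistory.

(** * The conditional law of the next reward *)

Section RewardKernel.
Local Open Scope ereal_scope.
Context {R : realType} {n : nat} {d : measure_display} {Omega : measurableType d}.
Variable pi : R -> seq R -> 'I_n.+1.
Hypothesis Hpi : policy_measurable pi.
Variables (U : Omega -> R) (X : 'I_n.+1 -> nat -> Omega -> R).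
Hypotheses (mU : measurable_fun setT U) (mX : forall i s, measurable_fun setT (X i s)).
Variables (P : probability Omega R)
  (law : 'I_n.+1 -> probability (R : measurableType _) R).
Hypothesis indep : mutually_independent P (stack_var U X).
Hypothesis Xlaw : forall i s (A : set R), measurable A -> P (X i s @^-1` A) = law i A.

Local Notation Xw w := (fun i s => X i s w).
Local Notation rew t w := (rewards pi (U w) (Xw w) t).
Local Notation arm t w := (next_arm pi (U w) (Xw w) t).

Let mstack k : measurable_fun setT (stack_var U X k).
Proof. by case: k => [[i s]|] /=. Qed.

(** The count is the one before the pull, so [s] is the zero-based position of the entry about to be
    read from the stack of arm [i]. *)
Definition pull_event t i s : set Omega :=
  [set w | arm t w = i] `&` [set w | pulls pi (U w) (Xw w) i t = s].

Lemma measurable_pull_event t i s : measurable (pull_event t i s).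
Proof.
have [mr mp] := measurable_history _ Hpi _ _ mU mX t.
by apply: measurableI => //; exact: (measurable_policy_preimage _ Hpi U mU t _ i mr).
Qed.

(* On the event that arm i is about to be pulled for the (s+1)-th time, the past
   is unchanged when X i s is replaced by 0, hence independent of X i s. *)
Lemma integral_pull_event t i s (F : R * t.+1.-tuple R -> \bar R) :
  measurable_fun setT F -> (forall z, 0 <= F z) ->
  \int[P]_w ((\1_(pull_event t i s) w)%:E *
             F (U w, [tuple of rcons (rew t w) (X i s w)])) =
  \int[P]_w ((\1_(pull_event t i s) w)%:E *
             \int[law i]_x F (U w, [tuple of rcons (rew t w) x])).
Proof.
move=> mF F0.
pose C := cylinders_without (stack_var U X) (Some (i, s)).
(* [T'] is [Omega] with the sigma-algebra of all coordinates but [X i s]; being measurable on [T']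
   is how independence from [X i s] is expressed. *)
pose T' : measurableType _ := g_sigma_algebraType C.
pose X' j r (w : T') : R := if (j, r) == (i, s) then 0%R else X j r w.
have XX' w j r : (j, r) != (i, s) -> X j r w = X' j r w.
  by rewrite /X' => /negbTE ->.
have mstack' k : k != Some (i, s) ->
    measurable_fun [set: T'] (stack_var U X k : T' -> R).
  move=> kis _ B mB; rewrite setTI; apply: sub_sigma_algebra.
  exact: cylinders_withoutP.
have mU' : measurable_fun [set: T'] (U : T' -> R) by exact: (mstack' None).
have mX' j r : measurable_fun [set: T'] (X' j r).
  have [jr|jr] := boolP ((j, r) == (i, s)).
    rewrite (_ : X' j r = cst 0%R); first exact: measurable_cst.
    by apply/funext => w; rewrite /X' jr.
  rewrite (_ : X' j r = X j r); first exact: (mstack' (Some (j, r))).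
  by apply/funext => w; rewrite -XX'.
have [mr' mp'] := measurable_history _ Hpi _ _ mU' mX' t.
have historyE w : pulls pi (U w) (Xw w) i t = s ->
    history pi (U w) (Xw w) t = history pi (U w) (fun j r => X' j r w) t.
  by move=> ps; apply: (eq_history _ _ _ _ i s t (XX' w)); rewrite ps.
have rewE w : pulls pi (U w) (Xw w) i t = s ->
    rew t w = rewards pi (U w) (fun j r => X' j r w) t.
  by move=> /historyE h; apply: val_inj; rewrite /= h.
have mD : measurable (pull_event t i s : set T').
  rewrite (_ : pull_event t i s =
    [set w : T' | next_arm pi (U w) (fun j r => X' j r w) t = i] `&`
    [set w : T' | pulls pi (U w) (fun j r => X' j r w) i t = s]).
    by apply: measurableI => //; exact: (measurable_policy_preimage _ Hpi _ mU' t _ i mr').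
  apply/seteqP; split=> w /=.
    by move=> [ai ps]; rewrite /pulls /next_arm -(historyE w ps) -(rewE w ps).
  move=> [ai ps].
  have ps' : pulls pi (U w) (Xw w) i t = s.
    by apply/eqP; rewrite (eq_history_pulls _ _ _ _ _ _ _ (XX' w)); apply/eqP.
  by split=> //; apply: etrans ai; rewrite /next_arm (rewE w ps').
pose H (z : T' * R) := (\1_(pull_event t i s) z.1)%:E *
  F (U z.1, [tuple of rcons (rew t z.1) z.2]).
have mH : measurable_fun setT H.
  rewrite (_ : H = fun z => (\1_(pull_event t i s) z.1)%:E *
    F (U z.1, [tuple of rcons (rewards pi (U z.1) (fun j r => X' j r z.1) t) z.2])).
    apply: emeasurable_funM.
      apply/measurable_EFinP.
      apply: (measurableT_comp (f := \1_(pull_event t i s) : T' -> R)) => //.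
    apply: (measurableT_comp mF); apply: measurable_fun_pair.
      exact: (measurableT_comp mU').
    apply: measurable_rcons => //.
    exact: (measurableT_comp mr').
  apply/funext => -[w x]; rewrite /H /= indicE.
  have [|] := boolP (w \in _); last by rewrite !mul0e.
  rewrite inE => -[_ /historyE hE]; congr (_ * F (_, _)).
  by apply: val_inj; rewrite /= hE.
have H0 z : 0 <= H z by rewrite mule_ge0// lee_fin.
transitivity (\int[P]_w H (w, X i s w)); first by [].
(* The role of [Y] is played by the identity of [Omega], seen as a map to the coarser space [T']. *)
rewrite (@integral_indep_fubini _ _ _ _ _ T' _ P (law i) (fun w => w : T') (X i s) H)//.
- apply: eq_integral => w _; rewrite /H /= ge0_integralZl//.
  + apply: (measurableT_comp mF); apply: measurable_fun_pair => //.
    exact: measurable_rcons.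
- move=> _ B mB; rewrite setTI preimage_id.
  have := cylinders_without_measurable _ mstack (Some (i, s)).
  move/(smallest_sub (@sigma_algebra_measurable _ Omega)); exact.
- move=> A B mA mB; rewrite preimage_id -(Xlaw i s)//.
  exact: (cylinders_without_indep _ mstack P indep (Some (i, s))).
Qed.

(** Given the past, the next reward follows the law of the chosen arm. The events [pull_event] cut
    [Omega] into finitely many pieces, since no count before round [t] exceeds [t], and each piece
    is handled by [integral_pull_event]. *)
Lemma integral_rewardsS t (F : R * t.+1.-tuple R -> \bar R) :
  measurable_fun setT F -> (forall z, 0 <= F z) ->
  \int[P]_w F (U w, rew t.+1 w) =
  \int[P]_w \int[law (arm t w)]_x F (U w, [tuple of rcons (rew t w) x]).
Proof.
move=> mF F0.
have [mr mp] := measurable_history _ Hpi _ _ mU mX t.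
have m1 i s : measurable_fun setT (fun w => (\1_(pull_event t i s) w)%:E : \bar R).
  by apply/measurable_EFinP/measurable_indic/measurable_pull_event.
(* Exactly one pair of arm and count is realized at [w], so a single term of the sum survives. *)
have sumE (G : 'I_n.+1 -> nat -> Omega -> \bar R) w :
    G (arm t w) (pulls pi (U w) (Xw w) (arm t w) t) w =
    \sum_(k : 'I_n.+1 * 'I_t.+1) (\1_(pull_event t k.1 k.2) w)%:E * G k.1 k.2 w.
  set s := pulls _ _ _ _ _.
  have st : (s < t.+1)%N by rewrite ltnS leq_pulls.
  rewrite (bigD1 (arm t w, Ordinal st))//= big1 ?adde0.
    by rewrite indicE mem_set ?mul1e.
  move=> [i r] /= ne; rewrite indicE memNset ?mul0e// => -[/= ai pr].
  move/negP: ne; apply; apply/eqP; congr (_, _) => //.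
  by apply: val_inj; rewrite /= -pr -ai.
pose G1 i s w := F (U w, [tuple of rcons (rew t w) (X i s w)]).
pose G2 i (s : nat) w := \int[law i]_x F (U w, [tuple of rcons (rew t w) x]).
transitivity (\int[P]_w \sum_(k : 'I_n.+1 * 'I_t.+1)
    (\1_(pull_event t k.1 k.2) w)%:E * G1 k.1 k.2 w).
  by apply: eq_integral => w _; rewrite -sumE /G1 -rewardsS.
have mG1 i s : measurable_fun setT (G1 i s).
  apply: (measurableT_comp mF); apply: measurable_fun_pair => //.
  exact: measurable_rcons.
have mG2 i s : measurable_fun setT (G2 i s).
  pose f (z : Omega * R) := F (U z.1, [tuple of rcons (rew t z.1) z.2]).
  apply: (@measurable_fun_fubini_tonelli_F _ _ _ _ _ (law i) f) => [|z]; last exact: F0.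
  apply: (measurableT_comp mF); apply: measurable_fun_pair => //.
    exact: (measurableT_comp mU).
  apply: measurable_rcons => //; exact: (measurableT_comp mr).
rewrite ge0_integral_sum//; last 2 first.
- by move=> k; exact: emeasurable_funM.
- by move=> k w _; apply: mule_ge0; [rewrite lee_fin|exact: F0].
transitivity (\int[P]_w \sum_(k : 'I_n.+1 * 'I_t.+1)
    (\1_(pull_event t k.1 k.2) w)%:E * G2 k.1 k.2 w); last first.
  by apply: eq_integral => w _; rewrite -sumE.
rewrite ge0_integral_sum//; last 2 first.
- by move=> k; exact: emeasurable_funM.
- by move=> k w _; apply: mule_ge0; [rewrite lee_fin|apply: integral_ge0 => x _].
by apply: eq_bigr => k _; exact: integral_pull_event.
Qed.

End RewardKernel.

(** * Bounded integrands and Jensen's inequality *)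

Section BoundedIntegral.
Local Open Scope ereal_scope.
Context {R : realType} {d : measure_display} {T : measurableType d}
  (P : probability T R).
Implicit Types (f : T -> R) (a b c : R).

Lemma integral_bounds f a b : (0 <= a)%R -> measurable_fun setT f ->
  (forall x, (a <= f x <= b)%R) -> a%:E <= \int[P]_x (f x)%:E <= b%:E.
Proof.
move=> a0 mf fab.
have intc c : (0 <= c)%R -> \int[P]_x c%:E = c%:E.
  by move=> c0; rewrite integral_cst//= probability_setT mule1.
have b0 : (0 <= b)%R.
  by case/andP: (fab point) => h1 h2; apply: le_trans h2; apply: le_trans h1.
rewrite -{1}(intc a)// -(intc b)//; apply/andP; split; apply: ge0_le_integral => //=.
- by apply/measurable_EFinP.
- by move=> x _; rewrite lee_fin; case/andP: (fab x).
- by move=> x _; rewrite lee_fin; case/andP: (fab x) => h _; apply: le_trans h.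
- by apply/measurable_EFinP.
- by move=> x _; rewrite lee_fin; case/andP: (fab x).
Qed.

Lemma integral_fineK f a b : (0 <= a)%R -> measurable_fun setT f ->
  (forall x, (a <= f x <= b)%R) ->
  (fine (\int[P]_x (f x)%:E))%:E = \int[P]_x (f x)%:E.
Proof.
move=> a0 mf /(integral_bounds _ _ _ a0 mf)/andP[h1 h2].
rewrite fineK// fin_numE -ltNye -ltey.
by rewrite (lt_le_trans _ h1) ?ltNyr//= (le_lt_trans h2) ?ltry.
Qed.

Lemma fine_integral_bounds f a b : (0 <= a)%R -> measurable_fun setT f ->
  (forall x, (a <= f x <= b)%R) -> (a <= fine (\int[P]_x (f x)%:E) <= b)%R.
Proof.
by move=> a0 mf fab; rewrite -!lee_fin (integral_fineK _ a b)// integral_bounds.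
Qed.

Lemma expR_bounds (c x : R) : (0 <= x <= c)%R -> (1 <= expR x <= expR c)%R.
Proof. by case/andP=> x0 xc; rewrite -expR0 !ler_expR x0. Qed.

(** Integrate [exp y >= 1 + y] at [y = f - ln I], with [I] the exponential moment. This is the case
    of equal laws, used when no reward has been observed. *)
Lemma jensen_ln f c : measurable_fun setT f -> (forall x, (0 <= f x <= c)%R) ->
  (fine (\int[P]_x (f x)%:E) <= ln (fine (\int[P]_x (expR (f x))%:E)))%R.
Proof.
move=> mf f0c; set I := fine (\int[P]_x (expR _)%:E).
have ef x := expR_bounds c _ (f0c x).
have mef : measurable_fun setT (fun x => expR (f x)) by exact: measurableT_comp.
have I1 : (1 <= I)%R by case/andP: (fine_integral_bounds _ 1 (expR c) ler01 mef ef).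
have I0 : (0 < I)%R by apply: lt_le_trans I1.
rewrite -lee_fin (integral_fineK _ 0 c)//.
have -> : ln I = (ln I - 1 + I / I)%R by rewrite divff ?subrK// gt_eqF.
have f0 x : 0 <= (f x)%:E by rewrite lee_fin; case/andP: (f0c x).
have Ef0 x : 0 <= (expR (f x))%:E by rewrite lee_fin expR_ge0.
have L0 : 0 <= (ln I)%:E by rewrite lee_fin ln_ge0.
have I'0 : 0 <= (I^-1)%:E by rewrite lee_fin invr_ge0 ltW.
have mEf : measurable_fun setT (fun x => (f x)%:E) by exact/measurable_EFinP.
have mEe : measurable_fun setT (fun x => (expR (f x))%:E) by exact/measurable_EFinP.
have lhsE : \int[P]_x ((f x)%:E + 1%:E) = \int[P]_x (f x)%:E + 1%:E.
  by rewrite ge0_integralD// integral_cst//= probability_setT mule1.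
have rhsE : \int[P]_x ((ln I)%:E + (I^-1)%:E * (expR (f x))%:E) = (ln I + I / I)%:E.
  rewrite ge0_integralD//.
  - rewrite integral_cst//= probability_setT mule1 ge0_integralZl//.
    by rewrite -(integral_fineK _ _ _ ler01 mef ef) -/I -EFinM -EFinD mulrC.
  - by move=> x _; rewrite mule_ge0.
  - exact: emeasurable_funM.
(* The pointwise inequality is arranged as [f + 1 <= ln I + exp f / I], where every term is
   nonnegative because [I >= 1]. *)
suff : \int[P]_x ((f x)%:E + 1%:E) <= \int[P]_x ((ln I)%:E + (I^-1)%:E * (expR (f x))%:E).
  rewrite lhsE rhsE -(integral_fineK _ 0 c)// -EFinD !lee_fin; lra.
apply: ge0_le_integral => //.
- by move=> x _; rewrite adde_ge0.
- exact: emeasurable_funD.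
- by apply: emeasurable_funD => //; exact: emeasurable_funM.
- move=> x _; rewrite -EFinM -!EFinD lee_fin.
  have := expR_ge1Dx (f x - ln I); rewrite expRB lnK// (mulrC I^-1%R); lra.
Qed.

End BoundedIntegral.

(** * The Donsker-Varadhan inequality for the whole interaction *)

Section BanditDonskerVaradhan.
Context {R : realType} {n : nat} {d : measure_display} {Omega : measurableType d}.
Variable pi : R -> seq R -> 'I_n.+1.
Hypothesis Hpi : policy_measurable pi.
Variables (U : Omega -> R) (X : 'I_n.+1 -> nat -> Omega -> R).
Hypotheses (mU : measurable_fun setT U) (mX : forall i s, measurable_fun setT (X i s)).
Variables (P Q : probability Omega R)
  (p q : 'I_n.+1 -> probability (R : measurableType _) R).
Hypotheses (indepP : mutually_independent P (stack_var U X))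
  (indepQ : mutually_independent Q (stack_var U X)).
Hypotheses
  (XP : forall i s (A : set R), measurable A -> P (X i s @^-1` A) = p i A)
  (XQ : forall i s (A : set R), measurable A -> Q (X i s @^-1` A) = q i A)
  (UPQ : forall A : set R, measurable A -> P (U @^-1` A) = Q (U @^-1` A)).

Local Notation rew t w := (rewards pi (U w) (fun i s => X i s w) t).
Local Notation arm t w := (next_arm pi (U w) (fun i s => X i s w) t).

Variable K : R.
Hypothesis K0 : 0 <= K.
(** The dual form of a bound [K] on the divergence of each arm; this section treats the arm laws
    through it alone. *)
Hypothesis one_arm : forall i (f : R -> R) (c : R),
  measurable_fun setT f -> (forall x, 0 <= f x <= c) ->
  fine (\int[p i]_x (f x)%:E)%E <= K + ln (fine (\int[q i]_x (expR (f x))%:E)%E).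

(* Backward induction on the horizon: the last reward is integrated out, and phi
   is replaced by its conditional log-moment under Q given the past. *)
Lemma bandit_donsker_varadhan t (phi : R * t.-tuple R -> R) (c : R) :
  measurable_fun setT phi -> (forall z, 0 <= phi z <= c) ->
  fine (\int[P]_w (phi (U w, rew t w))%:E)%E <=
    t%:R * K + ln (fine (\int[Q]_w (expR (phi (U w, rew t w)))%:E)%E).
Proof.
elim: t phi => [|t IH] phi mphi phi0c.
  (* Before any reward, [phi] depends on [U] only, whose law is the same under [P] and [Q]. *)
  rewrite mul0r add0r.
  pose f u := phi (u, [tuple]).
  have mf : measurable_fun setT f.
    by apply: (measurableT_comp mphi); exact: measurable_fun_pair.
  have phiE w : phi (U w, rew 0 w) = f (U w) by congr (phi (_, _)); apply: val_inj.
  under eq_integral do rewrite phiE.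
  under [in leRHS]eq_integral do rewrite phiE.
  have -> : (\int[P]_w (f (U w))%:E = \int[Q]_w (f (U w))%:E)%E.
    have f0 u : (0 <= (f u)%:E)%E by rewrite lee_fin; case/andP: (phi0c (u, [tuple])).
    have mEf : measurable_fun setT (EFin \o f) by exact/measurable_EFinP.
    rewrite -[LHS](ge0_integral_pushforward mU P measurableT mEf (fun u _ => f0 u)).
    rewrite -[RHS](ge0_integral_pushforward mU Q measurableT mEf (fun u _ => f0 u)).
    by apply: eq_measure_integral => A mA _; exact: UPQ.
  apply: (jensen_ln Q (f \o U) c) => [|w]; last exact: phi0c.
  exact: measurableT_comp.
have [mr mp] := measurable_history _ Hpi _ _ mU mX t.
have [mr' _] := measurable_history _ Hpi _ _ mU mX t.+1.
have mUr : measurable_fun setT (fun w => (U w, rew t w)) by exact: measurable_fun_pair.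
have mUr' : measurable_fun setT (fun w => (U w, rew t.+1 w)) by exact: measurable_fun_pair.
pose g (z : R * t.-tuple R) x := phi (z.1, [tuple of rcons z.2 x]).
have mg : measurable_fun setT (fun zx : (R * t.-tuple R) * R => g zx.1 zx.2).
  apply: (measurableT_comp mphi); apply: measurable_fun_pair.
    exact: measurableT_comp.
  by apply: measurable_rcons => //; exact: measurableT_comp.
have mgz z : measurable_fun setT (g z).
  by apply: (measurableT_comp mg (measurable_fun_pair _ _)).
have g0c z x : 0 <= g z x <= c by exact: phi0c.
have eg z x := expR_bounds c _ (g0c z x).
have meg z : measurable_fun setT (fun x => expR (g z x)) by exact: measurableT_comp.
pose I i z := (\int[q i]_x (expR (g z x))%:E)%E.
pose W (z : R * t.-tuple R) := ln (fine (I (pi z.1 z.2) z)).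
have I_bounds i z : 1 <= fine (I i z) <= expR c.
  exact: (fine_integral_bounds (q i) _ 1).
have I_fin i z : (fine (I i z))%:E = I i z.
  exact: (integral_fineK (q i) _ 1 (expR c)).
have W0c z : 0 <= W z <= c.
  have /andP[h1 h2] := I_bounds (pi z.1 z.2) z.
  by rewrite /W ln_ge0//= -(expRK c) ler_ln// posrE ?expR_gt0// (lt_le_trans _ h1).
have expW z : (expR (W z))%:E = I (pi z.1 z.2) z.
  have /andP[h1 h2] := I_bounds (pi z.1 z.2) z.
  by rewrite /W lnK ?I_fin// posrE (lt_le_trans _ h1).
have mI i : measurable_fun setT (I i).
  apply: (@measurable_fun_fubini_tonelli_F _ _ _ _ _ (q i)
    (fun zx => (expR (g zx.1 zx.2))%:E)) => [|z]; last by rewrite lee_fin expR_ge0.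
  by apply/measurable_EFinP; exact: measurableT_comp.
(* The law integrated against varies with the arm chosen at [z]; a sum of indicators over the
   finitely many arms separates the two dependences. *)
have mW : measurable_fun setT W.
  apply: measurableT_comp => //.
  apply: measurableT_comp; first exact: fine_measurable.
  rewrite (_ : (fun z => _) = fun z : R * t.-tuple R =>
     (\sum_(i < n.+1) (\1_[set z : R * t.-tuple R | pi z.1 z.2 = i] z)%:E * I i z)%E).
    apply: emeasurable_fun_sum => i; apply: emeasurable_funM => //.
    by apply/measurable_EFinP/measurable_indic; exact: Hpi.
  apply/funext => z; rewrite (bigD1 (pi z.1 z.2))//= big1 ?adde0.
    by rewrite indicE mem_set ?mul1e.
  move=> i /eqP ne; rewrite indicE memNset ?mul0e// => /= e.
  exact/ne/esym.
have c0 : 0 <= c by case/andP: (phi0c (0, nseq_tuple t.+1 0)); apply: le_trans.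
(* On the side of [Q], replacing [phi] by [W] is exact; one round therefore costs [K] on the side of
   [P] only. *)
have QE : (\int[Q]_w (expR (phi (U w, rew t.+1 w)))%:E =
           \int[Q]_w (expR (W (U w, rew t w)))%:E)%E.
  rewrite (integral_rewardsS _ Hpi _ _ mU mX _ _ indepQ XQ _ (fun z => (expR (phi z))%:E)).
  - by apply: eq_integral => w _; rewrite expW.
  - by apply/measurable_EFinP; exact: measurableT_comp.
  - by move=> z; rewrite lee_fin expR_ge0.
rewrite QE mulrSr mulrDl mul1r.
have := IH W mW W0c.
suff : fine (\int[P]_w (phi (U w, rew t.+1 w))%:E)%E <=
    K + fine (\int[P]_w (W (U w, rew t w))%:E)%E by lra.
have mWP : measurable_fun setT (fun w => W (U w, rew t w)) by exact: measurableT_comp.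
rewrite -lee_fin EFinD (integral_fineK P _ 0 c)//; last exact: measurableT_comp.
rewrite (integral_fineK P _ 0 c)//.
rewrite (integral_rewardsS _ Hpi _ _ mU mX _ _ indepP XP _ (fun z => (phi z)%:E)); last 2 first.
- exact/measurable_EFinP.
- by move=> z; rewrite lee_fin; case/andP: (phi0c z).
have -> : (K%:E = \int[P]_w K%:E)%E.
  by rewrite integral_cst//= probability_setT mule1.
rewrite -ge0_integralD//; last 2 first.
- by move=> w _; rewrite lee_fin; case/andP: (W0c (U w, rew t w)).
- exact/measurable_EFinP.
under [leRHS]eq_integral do rewrite -EFinD.
have phiE w : (\int[p (arm t w)]_x (phi (U w, [tuple of rcons (rew t w) x]))%:E =
    (fine (\int[p (arm t w)]_x (g (U w, rew t w) x)%:E))%:E)%E.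
  by rewrite (integral_fineK (p (arm t w)) _ 0 c).
rewrite [leLHS](_ : _ = (\int[P]_w
    (fine (\int[p (arm t w)]_x (g (U w, rew t w) x)%:E))%:E)%E); last first.
  by apply: eq_integral => w _; exact: phiE.
have dv w : fine (\int[p (arm t w)]_x (g (U w, rew t w) x)%:E)%E <=
    K + W (U w, rew t w) by exact: (one_arm _ _ c).
have mJ i : measurable_fun setT (fun z => \int[p i]_x (g z x)%:E)%E.
  apply: (@measurable_fun_fubini_tonelli_F _ _ _ _ _ (p i)
    (fun zx => (g zx.1 zx.2)%:E)) => [|z]; last first.
    by rewrite lee_fin; case/andP: (g0c z.1 z.2).
  by apply/measurable_EFinP.
apply: ge0_le_integral => //.
- move=> w _; rewrite lee_fin.
  by case/andP: (fine_integral_bounds (p (arm t w)) _ 0 c (lexx _) (mgz (U w, rew t w)) (g0c _)).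
- rewrite (_ : (fun w => _) = fun w =>
     (\sum_(i < n.+1) (\1_[set w | arm t w = i] w)%:E * \int[p i]_x (g (U w, rew t w) x)%:E)%E).
    apply: emeasurable_fun_sum => i; apply: emeasurable_funM => //.
      apply/measurable_EFinP/measurable_indic.
      exact: (measurable_policy_preimage _ Hpi U mU t _ i mr).
    exact: (measurableT_comp (mJ i) mUr).
  apply/funext => w; rewrite (integral_fineK (p (arm t w)) _ 0 c)//.
  rewrite (bigD1 (arm t w))//= big1 ?adde0.
    by rewrite indicE mem_set ?mul1e.
  move=> i /eqP ne; rewrite indicE memNset ?mul0e// => /= e.
  exact/ne/esym.
- by apply/measurable_EFinP; apply: measurable_funD.
- by move=> w _; rewrite lee_fin.
Qed.

End BanditDonskerVaradhan.

(** * The one-arm inequality in the exponential family *)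

Section ExponentialFamily.
Context {R : realType} (rho : {measure set R -> \bar R}).
Hypothesis Hrho : expfam_base rho.

Let unit_itv : set R := [set x | 0 <= x <= 1].

Let measurable_unit_itv : measurable unit_itv.
Proof.
rewrite (_ : unit_itv = `[0, 1]%classic); first exact: measurable_itv.
by apply/seteqP; split => x /=; rewrite in_itv.
Qed.

(* rho is carried by [0, 1]. *)
Lemma expfam_integrable (g : R -> R) (M : R) : measurable_fun setT g ->
  (forall x, 0 <= x <= 1 -> `|g x| <= M) -> rho.-integrable setT (EFin \o g).
Proof.
move=> mg gM; case: Hrho => rho01 rhoT _.
apply/(negligible_integrable _ _ _ rho01) => //; first exact: measurableC.
  exact/measurable_EFinP.
rewrite setDE setCK setTI; apply: measurable_bounded_integrable => //.
- apply: le_lt_trans rhoT; apply: le_measure => //; rewrite inE//.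
- exact: measurable_funTS.
- exists M; split; first exact: num_real.
  by move=> N MN x /= x01; apply: le_trans (ltW MN); exact: gM.
Qed.

Lemma normr_mul_unit (a x : R) : 0 <= x <= 1 -> `|a * x| <= `|a|.
Proof.
by case/andP=> x0 x1; rewrite normrM (ger0_norm x0) ler_piMr.
Qed.

Lemma measurable_ef_dens th : measurable_fun setT (ef_dens rho th).
Proof.
by apply: measurable_funM => //; apply: measurableT_comp => //.
Qed.

Lemma ef_Z_ge0 th : 0 <= ef_Z rho th.
Proof.
by rewrite fine_ge0//; apply: integral_ge0 => x _; rewrite lee_fin expR_ge0.
Qed.

Lemma ef_dens_ge0 th x : 0 <= ef_dens rho th x.
Proof. by rewrite divr_ge0 ?expR_ge0 ?ef_Z_ge0. Qed.

Lemma ef_dens_le th x : 0 <= x <= 1 -> `|ef_dens rho th x| <= expR `|th| / ef_Z rho th.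
Proof.
move=> x01; rewrite ger0_norm ?ef_dens_ge0//.
rewrite ler_wpM2r ?invr_ge0 ?ef_Z_ge0// ler_expR.
by apply: le_trans (ler_norm _) _; exact: normr_mul_unit.
Qed.

Definition has_ef_law (th : R) (p : probability (R : measurableType _) R) :=
  forall A : set R, measurable A -> p A = (\int[rho]_(x in A) (ef_dens rho th x)%:E)%E.

(** With a zero normalizer, division by zero would make the density vanish, and [p] would have total
    mass 0. *)
Lemma ef_Z_gt0 th p : has_ef_law th p -> 0 < ef_Z rho th.
Proof.
move=> pE; rewrite lt_neqAle ef_Z_ge0 andbT eq_sym; apply/eqP => Z0.
have := pE setT measurableT; rewrite probability_setT integral0_eq.
  by move/eqP; rewrite eqe oner_eq0.
by move=> x _; rewrite /ef_dens Z0 invr0 mulr0.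
Qed.

Lemma ef_integral th p (f : R -> R) : has_ef_law th p ->
  measurable_fun setT f -> (forall x, 0 <= f x) ->
  fine (\int[p]_x (f x)%:E)%E = \int[rho]_x (f x * ef_dens rho th x).
Proof.
move=> pE mf f0; rewrite (ge0_integral_density rho p (ef_dens rho th))//.
- exact: measurable_ef_dens.
- exact: ef_dens_ge0.
- exact/measurable_EFinP.
Qed.

(** The log-likelihood ratio [l] is affine, hence bounded on the interval carrying [rho], so all
    integrals are finite. Integrating [f dp + dp <= dp l + ln I dp + exp f dq / I] gives the claim,
    since [dp] and [exp f dq / I] both have integral 1 and cancel. *)
Lemma ef_donsker_varadhan th th' p q (f : R -> R) (c : R) :
  has_ef_law th p -> has_ef_law th' q ->
  measurable_fun setT f -> (forall x, 0 <= f x <= c) ->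
  fine (\int[p]_x (f x)%:E)%E <=
    ef_kl rho th th' + ln (fine (\int[q]_x (expR (f x))%:E)%E).
Proof.
move=> pE qE mf f0c.
have Zp := ef_Z_gt0 _ _ pE; have Zq := ef_Z_gt0 _ _ qE.
have f0 x : 0 <= f x by case/andP: (f0c x).
have mef : measurable_fun setT (fun x => expR (f x)) by exact: measurableT_comp.
have I1 : 1 <= fine (\int[q]_x (expR (f x))%:E)%E.
  by case/andP: (fine_integral_bounds q _ 1 (expR c) ler01 mef (fun x => expR_bounds c _ (f0c x))).
rewrite (ef_integral _ _ _ pE mf f0).
move: I1; rewrite (ef_integral _ _ _ qE mef) => [|x]; last exact: expR_ge0.
set I := Rintegral _ _ _ => I1.
have I0 : 0 < I by apply: lt_le_trans I1.
pose dp := ef_dens rho th; pose dq := ef_dens rho th'.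
have mdp : measurable_fun setT dp := measurable_ef_dens th.
have mdq : measurable_fun setT dq := measurable_ef_dens th'.
have dp0 x : 0 < dp x by rewrite divr_gt0 ?expR_gt0.
have dq0 x : 0 < dq x by rewrite divr_gt0 ?expR_gt0.
pose l x := ln (dp x / dq x).
have lE x : l x = (th - th') * x + (ln (ef_Z rho th') - ln (ef_Z rho th)).
  rewrite /l; have -> : dp x / dq x = expR ((th - th') * x) * (ef_Z rho th' / ef_Z rho th).
    rewrite /dp /dq /ef_dens invf_div mulrBl expRB.
    by field; rewrite ?gt_eqF ?expR_gt0.
  rewrite lnM ?posrE ?expR_gt0 ?divr_gt0// expRK.
  by rewrite ln_div ?posrE.
have ml : measurable_fun setT l.
  rewrite (_ : l = fun x => (th - th') * x + (ln (ef_Z rho th') - ln (ef_Z rho th))).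
    by apply: measurable_funD => //; exact: measurable_funM.
  by apply/funext.
pose Ml := `|th - th'| + `|ln (ef_Z rho th') - ln (ef_Z rho th)|.
have lM x : 0 <= x <= 1 -> `|l x| <= Ml.
  move=> x01; rewrite lE (le_trans (ler_normD _ _))// lerD2r.
  exact: normr_mul_unit.
pose Mp := expR `|th| / ef_Z rho th; pose Mq := expR `|th'| / ef_Z rho th'.
have dpM x : 0 <= x <= 1 -> `|dp x| <= Mp by exact: ef_dens_le.
have dqM x : 0 <= x <= 1 -> `|dq x| <= Mq by exact: ef_dens_le.
have i_p : rho.-integrable setT (EFin \o dp) by exact: expfam_integrable dpM.
have i_fp : rho.-integrable setT (EFin \o (fun x => f x * dp x)).
  apply: (@expfam_integrable _ (c * Mp)) => [|x x01]; first exact: measurable_funM mf mdp.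
  by rewrite normrM ler_pM// ?dpM// ger0_norm; case/andP: (f0c x).
have i_eq : rho.-integrable setT (EFin \o (fun x => expR (f x) * dq x)).
  apply: (@expfam_integrable _ (expR c * Mq)) => [|x x01]; first exact: measurable_funM mef mdq.
  rewrite normrM ler_pM// ?dqM// ger0_norm ?expR_ge0// ler_expR.
  by case/andP: (f0c x).
have i_lp : rho.-integrable setT (EFin \o (fun x => dp x * l x)).
  apply: (@expfam_integrable _ (Mp * Ml)) => [|x x01]; first exact: measurable_funM mdp ml.
  by rewrite normrM ler_pM// ?dpM// lM.
have i_Lp : rho.-integrable setT (EFin \o (fun x => ln I * dp x)).
  apply: (@expfam_integrable _ (`|ln I| * Mp)) => [|x x01]; first exact: measurable_funM (measurable_cst _) mdp.
  by rewrite normrM ler_wpM2l// dpM.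
have i_eqI : rho.-integrable setT (EFin \o (fun x => I^-1 * (expR (f x) * dq x))).
  apply: (@expfam_integrable _ (I^-1 * (expR c * Mq))) => [|x x01].
    exact: measurable_funM (measurable_cst _) (measurable_funM mef mdq).
  rewrite normrM gtr0_norm ?invr_gt0// ler_pM2l ?invr_gt0//.
  rewrite normrM ler_pM// ?dqM// ger0_norm ?expR_ge0// ler_expR.
  by case/andP: (f0c x).
have int_p : \int[rho]_x dp x = 1.
  by rewrite /Rintegral -pE// probability_setT.
have klE : ef_kl rho th th' = \int[rho]_x (dp x * l x) by [].
have i1 : rho.-integrable setT (EFin \o (fun x => f x * dp x + dp x)).
  exact: (integrableD measurableT i_fp i_p).
have i2 : rho.-integrable setT (EFin \o (fun x => dp x * l x + ln I * dp x)).
  exact: (integrableD measurableT i_lp i_Lp).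
have i3 : rho.-integrable setT
    (EFin \o (fun x => dp x * l x + ln I * dp x + I^-1 * (expR (f x) * dq x))).
  exact: (integrableD measurableT i2 i_eqI).
have := le_Rintegral measurableT i1 i3.
rewrite (RintegralD measurableT i_fp i_p) (RintegralD measurableT i2 i_eqI).
rewrite (RintegralD measurableT i_lp i_Lp) (RintegralZl _ measurableT i_p).
rewrite (RintegralZl _ measurableT i_eq) int_p klE mulr1.
rewrite -/I mulVf ?gt_eqF// lerD2r; apply=> x _.
(* exp y >= 1 + y at y = f - l - ln I, multiplied by the density of p *)
have dqE : dp x * expR (f x - l x - ln I) = I^-1 * (expR (f x) * dq x).
  rewrite !expRB /l !lnK ?posrE ?(divr_gt0 (dp0 x) (dq0 x))//.
  move: (dp x) (dq x) (expR (f x)) (I) (dp0 x) (dq0 x) I0 => u v w J u0 v0 J0.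
  by clear -u0 v0 J0; field; rewrite !gt_eqF.
have := expR_ge1Dx (f x - l x - ln I).
rewrite -(ler_pM2l (dp0 x)) dqE.
move: (f x) (dp x) (l x) (ln I) (I^-1 * _) => a b e g h; clear; lra.
Qed.

End ExponentialFamily.

(** * A numerical lower bound on the binary divergence *)

Section BinaryDivergence.
Context {R : realType}.
Implicit Types x y a : R.

(** The left side is the tangent at [1 / a] of the convex function [- ln z] of [z = 1 / y], so
    equality holds at [y = a]. *)
Lemma ln_tangent_ge a y : 0 < a -> 0 < y -> ln a + 1 - a / y <= ln y.
Proof.
move=> a0 y0; have ay0 : 0 < a / y by rewrite divr_gt0.
have h : -1 < a / y - 1 by lra.
have := le_ln1Dx h; rewrite (_ : 1 + (a / y - 1) = a / y); last by lra.
by rewrite ln_div ?posrE//; lra.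
Qed.

Lemma series_exp_coeff_le x k : 0 <= x -> series (exp_coeff x) k <= expR x.
Proof.
move=> x0; apply: nondecreasing_cvgn_le; last exact: is_cvg_series_exp_coeff.
by apply: nondecreasing_series => i _ _; exact: exp_coeff_ge0.
Qed.

Lemma expR_ge_taylor5 x : 0 <= x ->
  1 + x + x ^+ 2 / 2 + x ^+ 3 / 6 + x ^+ 4 / 24 + x ^+ 5 / 120 <= expR x.
Proof.
move=> x0; apply: le_trans (series_exp_coeff_le _ 6 x0).
rewrite /series /exp_coeff /= !big_nat_recr//= big_nil !factS fact0 !muln1.
by rewrite add0r expr0 expr1 !divr1.
Qed.

Lemma ln2_le : ln 2 <= 6933 / 10000 :> R.
Proof.
rewrite -[leRHS]expRK ler_ln ?posrE ?expR_gt0//.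
by apply: le_trans (expR_ge_taylor5 _ _); lra.
Qed.

(** Each use halves the exponent at the price of one squaring, until [1 + x] is sharp enough. *)
Lemma expR_ge_half_sqr x a b : 0 <= a -> a <= expR (x / 2) -> b <= a * a ->
  b <= expR x.
Proof.
move=> a0 ax; rewrite [in expR x](splitr x) expRD => /le_trans; apply.
exact: ler_pM.
Qed.

Lemma ln_8div5_ge : 465 / 1000 <= ln (8 / 5) :> R.
Proof.
have h : (625 + 973 / 1000) / 1000 <= expR (- (465 / 1000)) :> R.
  (* Five halvings bring the exponent to [- 465 / 32000]. The square of each constant dominates the
     preceding one, the first being compared with a number above [5 / 8]. *)
  apply: (@expR_ge_half_sqr _ ((791 + 185 / 1000) / 1000)); [lra| |lra].
  apply: (@expR_ge_half_sqr _ ((889 + 486 / 1000) / 1000)); [lra| |lra].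
  apply: (@expR_ge_half_sqr _ ((943 + 126 / 1000) / 1000)); [lra| |lra].
  apply: (@expR_ge_half_sqr _ ((971 + 147 / 1000) / 1000)); [lra| |lra].
  apply: (@expR_ge_half_sqr _ ((985 + 468 / 1000) / 1000)); [lra| |lra].
  by apply: le_trans (expR_ge1Dx _); lra.
have P85 : (0 : R) < 8 / 5 by lra.
rewrite -ler_expR lnK ?posrE//.
rewrite -[X in expR X]opprK expRN.
have e0 := expR_gt0 (- (465 / 1000) : R).
rewrite -[leRHS]invrK lef_pV2 ?posrE ?invr_gt0//.
by apply: le_trans h; lra.
Qed.

(* The tangents of ln at 2/3 and 1/3: the two sides are closest near
   x = 0.323, where they differ by 0.007. *)
Lemma binary_divergence_ge x : 0 < x -> x <= 1 / 2 ->
  - ln (24 / 10 * x) <= (1 - 2 * x) * ln ((1 - x) / x).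
Proof.
move=> x0 x2; have x1 : 0 < 1 - x by lra.
have t1 := ln_tangent_ge (2 / 3) (1 - x) ltac:(lra) x1.
have t2 := ln_tangent_ge (1 / 3) x ltac:(lra) x0.
have l2 := ln2_le; have l85 := ln_8div5_ge.
have P2 : (2 : R) \in Num.pos by rewrite posrE ltr0n.
have P3 : (3 : R) \in Num.pos by rewrite posrE ltr0n.
have P85 : (8 / 5 : R) \in Num.pos by rewrite posrE divr_gt0 ?ltr0n.
have P32 : (3 / 2 : R) \in Num.pos by rewrite posrE divr_gt0 ?ltr0n.
have Px : x \in Num.pos by rewrite posrE.
(* With [24 / 10 = (8 / 5) * (3 / 2)], the terms in [ln 3] cancel against those of the two tangents;
   an upper bound on [ln 2] and a lower bound on [ln (8 / 5)] then suffice. *)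
have e24 : ln (24 / 10 * x) = ln (8 / 5) + (ln 3 - ln 2) + ln x.
  have -> : 24 / 10 * x = (8 / 5) * (3 / 2) * x by clear; lra.
  by rewrite (lnM (rpredM P85 P32) Px) (lnM P85 P32) (ln_div P3 P2).
have e1x : ln ((1 - x) / x) = ln (1 - x) - ln x by rewrite ln_div ?posrE.
have e23 : ln (2 / 3) = ln 2 - ln 3 :> R by rewrite (ln_div P2 P3).
have e13 : ln (1 / 3) = - ln 3 :> R by rewrite div1r lnV.
rewrite e24 e1x; rewrite e23 in t1; rewrite e13 in t2.
set L2 := ln 2 in l2 t1 *; set L3 := ln 3 in t1 t2 *.
set Lx := ln x in t2 *; set Ly := ln (1 - x) in t1 *; set A := ln (8 / 5) in l85 *.
clear e24 e1x e23 e13 P2 P3 P85 P32 Px.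
have h1 : (1 - 2 * x) * (L2 - L3 + 1 - 2 / 3 / (1 - x)) <= (1 - 2 * x) * Ly.
  by rewrite ler_wpM2l//; lra.
have h2 : 2 * x * (- L3 + 1 - 1 / 3 / x) <= 2 * x * Lx by rewrite ler_wpM2l//; lra.
have e1 : (1 - 2 * x) * (2 / 3 / (1 - x)) = 4 / 3 - 2 / 3 / (1 - x).
  by field; rewrite gt_eqF.
have e2 : 2 * x * (1 / 3 / x) = 2 / 3 by field; rewrite gt_eqF.
have h3 : 0 <= - 1 + 465 / 1000 - 2 * x * (6933 / 10000) + 2 / 3 / (1 - x).
  rewrite -(pmulr_rge0 _ x1).
  have -> : (1 - x) * (- 1 + 465 / 1000 - 2 * x * (6933 / 10000) + 2 / 3 / (1 - x)) =
     (1 - x) * (- 1 + 465 / 1000 - 2 * x * (6933 / 10000)) + 2 / 3.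
    by field; rewrite gt_eqF.
  (* The remaining quadratic in [x] is convex with its vertex near 0.307 and is positive there. *)
  by have := sqr_ge0 (x - 307 / 1000); rewrite expr2; clear -x2; lra.
have h4 : x * L2 <= x * (6933 / 10000) by rewrite ler_pM2l.
set i1 := 2 / 3 / (1 - x) in h1 e1 h3 *; set i2 := 1 / 3 / x in h2 e2 *.
clear -h1 h2 h3 h4 e1 e2 l85; lra.
Qed.

End BinaryDivergence.

(** * Gaps, savings and the ordering of the arms *)

Section Instances.
Context {R : realType} (rho : {measure set R -> \bar R}) {n : nat}.
Variables (th : 'I_n.+1 -> R) (T TFE : nat).

Lemma inst_mean_le_best i : inst_mean rho th i <= inst_mean rho th (best_arm rho th).
Proof.
have : extremum_spec >=%O xpredT (inst_mean rho th) (best_arm rho th).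
  exact: arg_maxP.
by case=> j _ /(_ i isT).
Qed.

Lemma gap_ge0 i : 0 <= gap rho th i.
Proof. by rewrite subr_ge0 inst_mean_le_best. Qed.

(** Removing the cap [cc] only increases the sum, and arms with zero gap contribute nothing. *)
Lemma save_hat_le (cnt : 'I_n.+1 -> nat) :
  (save_hat rho th T cnt <= (\sum_i gap rho th i * (cnt i)%:R)%:E)%E.
Proof.
rewrite /save_hat -sumEFin [leRHS](bigID (fun i => 0 < gap rho th i))/=.
rewrite [X in (_ <= _ + X)%E]big1 ?adde0 => [|i]; last first.
  by rewrite -leNgt => gi; rewrite (@le_anti _ _ (gap rho th i) 0) ?mul0r// gi gap_ge0.
apply: lee_sum => i gi; rewrite EFinM; apply: lee_wpmul2l; first by rewrite lee_fin gap_ge0.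
by rewrite ge_min lexx.
Qed.

Lemma size_sorted_arms : size (sorted_arms rho th) = n.+1.
Proof. by rewrite size_sort size_enum_ord. Qed.

Lemma sorted_arms_le p q : (p <= q)%N -> (q < n.+1)%N ->
  inst_mean rho th (arm_at rho th q) <= inst_mean rho th (arm_at rho th p).
Proof.
move=> pq qn; rewrite /arm_at.
pose leT i j := inst_mean rho th j <= inst_mean rho th i.
have tr : transitive leT by move=> j i k ij jk; exact: le_trans jk ij.
have rf : reflexive leT by move=> i; exact: lexx.
have tot : total leT by move=> i j; exact: le_total.
have szE := size_sorted_arms.
have srt : sorted leT (sorted_arms rho th) by exact: sort_sorted.
have := sorted_leq_nth tr rf ord0 srt p q.
rewrite !inE szE => h.
exact: (h (leq_ltn_trans pq qn) qn pq).
Qed.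

End Instances.

(** * Savings on an instance with two mean levels *)

Section TwoLevelInstance.
Context {R : realType} (rho : {measure set R -> \bar R}) {n : nat}.
Variables (A : pred 'I_n.+1) (lo hi : R) (T TFE : nat).
Let th i := if A i then lo else hi.
Hypothesis lo_hi : ef_mean rho lo < ef_mean rho hi.
Hypothesis exists_high : exists i, ~~ A i.

Let xi := ef_mean rho hi - ef_mean rho lo.

Lemma two_level_mean i :
  inst_mean rho th i = if A i then ef_mean rho lo else ef_mean rho hi.
Proof. by rewrite /inst_mean /th; case: ifP. Qed.

Lemma two_level_best : ~~ A (best_arm rho th).
Proof.
have [i Ai] := exists_high; apply/negP => Ab.
have := inst_mean_le_best rho th i.
by rewrite !two_level_mean (negbTE Ai) Ab leNgt lo_hi.
Qed.

Lemma two_level_gap i : gap rho th i = if A i then xi else 0.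
Proof.
rewrite /gap !two_level_mean (negbTE two_level_best).
by case: ifP => // _; rewrite subrr.
Qed.

Lemma two_level_save_hat (cnt : 'I_n.+1 -> nat) :
  (save_hat rho th T cnt <= (xi * (\sum_(i | A i) cnt i)%N%:R)%:E)%E.
Proof.
apply: le_trans (save_hat_le rho th T cnt) _; rewrite lee_fin.
rewrite le_eqVlt; apply/orP; left; apply/eqP.
rewrite [in RHS]natr_sum [RHS]mulr_sumr [RHS]big_mkcond.
apply: eq_bigr => i _; rewrite two_level_gap.
by case: (A i) => //; rewrite mul0r.
Qed.

Hypothesis TFE_lt : TFE%:R < #|A|%:R * ln (T%:R) / ef_kl rho lo hi.

Let c := ln (T%:R) / ef_kl rho lo hi.

Let Ac : TFE%:R < #|A|%:R * c. Proof. by rewrite mulrA. Qed.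

Let c_gt0 : 0 < c.
Proof.
rewrite ltNge; apply/negP => c0.
have : #|A|%:R * c <= 0 by rewrite mulr_ge0_le0.
by rewrite leNgt (le_lt_trans _ Ac).
Qed.

(** A zero divergence would make the quotient [c] equal to 0, against its positivity, so [cc] takes
    its finite branch. *)
Lemma two_level_cc i : A i -> cc rho th T i = c%:E.
Proof.
move=> Ai; rewrite /cc.
have -> : th i = lo by rewrite /th Ai.
have -> : th (best_arm rho th) = hi by rewrite /th (negbTE two_level_best).
by case: eqP => // k0; move: c_gt0; rewrite /c k0 invr0 mulr0 ltxx.
Qed.

(** In sorted order the low arms occupy all positions from [p0] on. Their costs alone exceed the
    budget, so [iFE] is one of these positions; every gap from there on is [xi], and the costs
    cancel in [save_star]. *)
Lemma two_level_save_star : save_star rho th T TFE = (xi * TFE%:R)%:E.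
Proof.
pose s := sorted_arms rho th; pose p0 := find A s.
have szs : size s = n.+1 := size_sorted_arms rho th.
have countA : count A s = #|A|.
  by rewrite /s /sorted_arms count_sort cardE -size_filter /enum_mem filter_predT.
have A_gt0 : (0 < #|A|)%N.
  rewrite lt0n; apply/eqP => A0; move: Ac; rewrite A0 mul0r.
  by rewrite ltNge ler0n.
have hasA : has A s by rewrite has_count countA.
have p0n : (p0 < n.+1)%N by rewrite -szs -has_find.
have Ap0 : A (arm_at rho th p0) by exact: nth_find.
have Ap p : (p0 <= p)%N -> (p < n.+1)%N -> A (arm_at rho th p).
  move=> p0p pn; have := sorted_arms_le rho th p0 p p0p pn.
  rewrite !two_level_mean Ap0; case: ifP => // _.
  by rewrite leNgt lo_hi.
have A_le : (#|A| <= n.+1 - p0)%N.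
  rewrite -countA -(cat_take_drop p0 s) count_cat.
  have -> : count A (take p0 s) = 0%N.
    by apply/eqP; rewrite -leqn0 leqNgt -has_count has_take// ltnn.
  by rewrite add0n (leq_trans (count_size _ _))// size_drop szs.
have tailE (F : 'I_n.+1 -> \bar R) (r : R) k : (p0 <= k)%N ->
    (forall i, A i -> F i = r%:E) ->
    (\sum_(k <= p < n.+1) F (arm_at rho th p) = ((n.+1 - k)%:R * r)%:E)%E.
  move=> p0k Fr; rewrite (eq_big_nat _ _ (F2 := fun=> r%:E)) => [|p /andP[kp pn]].
    by rewrite sumEFin sumr_const_nat mulr_natl.
  by rewrite Fr// Ap// (leq_trans p0k).
set k := iFE rho th T TFE.
(* Position [p0] is admissible in the maximum defining [iFE]: at least [#|A|] low arms remain from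
   there, and [#|A|%:R * c] exceeds [TFE]. *)
have p0k : (p0 <= k)%N.
  apply: (@leq_bigmax_cond _ _ (fun k : 'I_n.+1 => k : nat) (Ordinal p0n)).
  rewrite /= /tail_c (tailE _ c)//; last exact: two_level_cc.
  rewrite lee_fin; apply: le_trans (ltW Ac) _.
  by rewrite ler_pM2r// ler_nat.
have kn : (k < n.+1)%N.
  by rewrite ltnS; apply/bigmax_leqP => i _; rewrite -ltnS.
rewrite /save_star -/k (tailE _ c) ?(leq_trans p0k)//; last exact: two_level_cc.
rewrite (tailE (fun i => (gap rho th i)%:E * cc rho th T i)%E (xi * c)) ?(leq_trans p0k)//; last first.
  by move=> i Ai; rewrite two_level_gap Ai two_level_cc.
rewrite two_level_gap Ap// -EFinB -EFinM -EFinD; congr EFin.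
by ring.
Qed.

End TwoLevelInstance.

(** * Pull counts read off the observed rewards *)

Section CountEvents.
Context {R : realType} {n : nat}.
Variable pi : R -> seq R -> 'I_n.+1.

(** Replaying the policy on each prefix of the rewards recovers the counts, so events about them
    become events about the observations. *)
Definition counts t (z : R * t.-tuple R) (i : 'I_n.+1) : nat :=
  (\sum_(s < t) (pi z.1 (take s z.2) == i))%N.

Lemma take_rewards u X s t : (s <= t)%N ->
  take s (rewards pi u X t) = rewards pi u X s.
Proof.
elim: t => [|t IH]; first by rewrite leqn0 => /eqP ->.
rewrite leq_eqVlt => /orP[/eqP ->|]; first by rewrite take_oversize// size_tuple.
rewrite ltnS => st; rewrite rewardsS /= -cats1 take_cat (eqP (size_history pi u X t)).
move: (st); rewrite leq_eqVlt => /orP[/eqP ->|->]; last exact: IH.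
by rewrite ltnn subnn take0 cats0.
Qed.

Lemma pulls_counts u X t i : pulls pi u X i t = counts t (u, rewards pi u X t) i.
Proof.
rewrite /counts.
transitivity (\sum_(s < t) (next_arm pi u X s == i : nat))%N.
  elim: t => [|t IH]; first by rewrite big_ord0.
  by rewrite big_ord_recr/= pullsS IH.
apply: eq_bigr => s _; rewrite -[rewards pi u X t in RHS]/(rewards pi u X t).
by rewrite /next_arm take_rewards// ltnW.
Qed.

Lemma sum_pulls u X t : (\sum_i pulls pi u X i t = t)%N.
Proof.
elim: t => [|t IH]; first by rewrite big1.
under eq_bigr do rewrite pullsS.
rewrite big_split/= IH (bigD1 (next_arm pi u X t))//= eqxx big1 => [|i].
  by rewrite addn0 addn1.
by rewrite eq_sym => /negbTE ->.
Qed.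

Hypothesis Hpi : policy_measurable pi.

Lemma measurable_policy_take t (s : 'I_t) i :
  measurable [set z : R * t.-tuple R | pi z.1 (take s z.2) = i].
Proof.
pose g (z : R * t.-tuple R) : s.-tuple R :=
  [tuple tnth z.2 (widen_ord (ltnW (ltn_ord s)) j) | j < s].
have gE z : tval (g z) = take s z.2.
  apply: (@eq_from_nth _ 0) => [|j]; first by rewrite size_tuple size_takel ?size_tuple// ltnW.
  rewrite size_tuple => js.
  by rewrite -[j]/(nat_of_ord (Ordinal js)) -tnth_nth tnth_mktuple (tnth_nth 0) /= nth_take.
have mg : measurable_fun setT g.
  apply/measurable_fun_tnthP => j.
  rewrite (_ : _ \o _ = (@tnth t R ^~ (widen_ord (ltnW (ltn_ord s)) j)) \o snd).
    by apply: measurableT_comp => //; exact: measurable_tnth.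
  by apply/funext => z; rewrite /= tnth_mktuple.
rewrite (_ : mkset _ = [set z | pi z.1 (g z) = i]); last first.
  by apply/seteqP; split=> z /=; rewrite gE.
exact: (measurable_policy_preimage pi Hpi fst measurable_fst s g i mg).
Qed.

(** The counts are determined by the sequence of arms chosen in [t] rounds; there are finitely many
    such sequences, so the set is a finite union of measurable sets. *)
Lemma measurable_counts t (S : ('I_n.+1 -> nat) -> Prop) :
  measurable [set z : R * t.-tuple R | S (counts t z)].
Proof.
pose arms (z : R * t.-tuple R) := [ffun s : 'I_t => pi z.1 (take s z.2)].
pose cnt (f : {ffun 'I_t -> 'I_n.+1}) i : nat := (\sum_(s < t) (f s == i))%N.
have cntE z : counts t z = cnt (arms z).
  by apply/funext => i; apply: eq_bigr => s _; rewrite ffunE.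
rewrite (_ : mkset _ = \big[setU/set0]_(f : {ffun 'I_t -> 'I_n.+1} | `[< S (cnt f) >])
    \big[setI/setT]_(s < t) [set z : R * t.-tuple R | pi z.1 (take s z.2) = f s]).
  apply: bigsetU_measurable => f _; apply: bigsetI_measurable => s _.
  exact: measurable_policy_take.
apply/seteqP; split=> z /=.
  rewrite cntE => Sz; rewrite -bigcup_seq_cond.
  exists (arms z); first by rewrite /= mem_index_enum; apply/asboolP.
  by rewrite -bigcap_seq => s _ /=; rewrite ffunE.
rewrite -bigcup_seq_cond => -[f /= /andP[_ /asboolP Sf]].
rewrite -bigcap_seq => h; rewrite cntE (_ : arms z = f)//.
by apply/ffunP => s; rewrite ffunE; apply: h; rewrite /= mem_index_enum.
Qed.

End CountEvents.

(** * Change of measure for a single event *)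

Section ChangeOfMeasure.
Context {R : realType} {d : measure_display} {Omega : measurableType d}.

Lemma fine_integral_scaled_indic (P : probability Omega R) (A : set Omega) (a b : R) :
  measurable A -> 0 <= a -> 0 <= b ->
  fine (\int[P]_w (a + b * \1_A w)%:E)%E = a + b * fine (P A).
Proof.
move=> mA a0 b0.
have mI : measurable_fun setT (fun w => (\1_A w)%:E : \bar R).
  by apply/measurable_EFinP/measurable_indic.
have I0 w : (0 <= (\1_A w)%:E :> \bar R)%E by rewrite lee_fin.
under eq_integral do rewrite EFinD EFinM.
rewrite ge0_integralD//=; last 2 first.
- by move=> w _; rewrite -EFinM lee_fin mulr_ge0.
- exact: emeasurable_funM.
rewrite integral_cst//= probability_setT mule1 ge0_integralZl//.
rewrite integral_indic// setIT.
by rewrite -[X in (_ + _ * X)%E]fineK ?fin_num_measure// -EFinM -EFinD.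
Qed.

Context {n : nat}.
Variable pi : R -> seq R -> 'I_n.+1.
Hypothesis Hpi : policy_measurable pi.
Variables (U : Omega -> R) (X : 'I_n.+1 -> nat -> Omega -> R).
Hypotheses (mU : measurable_fun setT U) (mX : forall i s, measurable_fun setT (X i s)).
Variables (P Q : probability Omega R)
  (p q : 'I_n.+1 -> probability (R : measurableType _) R).
Hypotheses (indepP : mutually_independent P (stack_var U X))
  (indepQ : mutually_independent Q (stack_var U X)).
Hypotheses
  (XP : forall i s (A : set R), measurable A -> P (X i s @^-1` A) = p i A)
  (XQ : forall i s (A : set R), measurable A -> Q (X i s @^-1` A) = q i A)
  (UPQ : forall A : set R, measurable A -> P (U @^-1` A) = Q (U @^-1` A)).
Variable K : R.
Hypothesis K0 : 0 <= K.
Hypothesis one_arm : forall i (f : R -> R) (c : R),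
  measurable_fun setT f -> (forall x, 0 <= f x <= c) ->
  fine (\int[p i]_x (f x)%:E)%E <= K + ln (fine (\int[q i]_x (expR (f x))%:E)%E).

Local Notation past t := (fun w => (U w, rewards pi (U w) (fun i s => X i s w) t)).

(* The log-moment inequality for c 1_C, with exp c = ((1 - x) / x)^2 the optimal
   choice for the binary divergence between 1 - x and x. *)
Lemma bandit_event_divergence t (C : set (R * t.-tuple R)) (x : R) :
  measurable C -> 0 < x -> x <= 1 / 2 ->
  1 - x <= fine (P (past t @^-1` C)) -> fine (Q (past t @^-1` C)) <= x ->
  - ln (24 / 10 * x) <= t%:R * K.
Proof.
move=> mC x0 x2 PC QC.
pose r := (1 - x) / x.
have r1 : 1 <= r by rewrite /r ler_pdivlMr// mul1r; lra.
have r0 : 0 < r by apply: lt_le_trans r1.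
pose c := ln r + ln r.
have lr0 : 0 <= ln r by rewrite ln_ge0.
have c0 : 0 <= c by rewrite addr_ge0.
have ec : expR c = r * r by rewrite /c expRD lnK.
have [mr _] := measurable_history pi Hpi U X mU mX t.
have mZ : measurable_fun setT (past t) by exact: measurable_fun_pair.
have mZC : measurable (past t @^-1` C) by rewrite -[X in measurable X]setTI; exact: mZ.
pose phi z : R := 0 + c * \1_C z.
have phi0c z : 0 <= phi z <= c.
  by rewrite /phi add0r indicE; case: (z \in C); rewrite ?mulr1 ?mulr0 ?lexx ?c0.
have mphi : measurable_fun setT phi.
  by apply: measurable_funD => //; apply: measurable_funM => //; exact: measurable_indic.
have := bandit_donsker_varadhan pi Hpi U X mU mX P Q p q indepP indepQ XP XQ UPQ K K0
  one_arm t phi c mphi phi0c.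
have -> : fine (\int[P]_w (phi (past t w))%:E)%E = c * fine (P (past t @^-1` C)).
  by rewrite -[RHS]add0r -fine_integral_scaled_indic.
have -> : fine (\int[Q]_w (expR (phi (past t w)))%:E)%E =
    1 + (r * r - 1) * fine (Q (past t @^-1` C)).
  rewrite -fine_integral_scaled_indic//; last by rewrite subr_ge0; nra.
  congr fine; apply: eq_integral => w _; congr EFin.
  rewrite /phi !indicE add0r; have -> : (w \in past t @^-1` C) = (past t w \in C).
    by apply/idP/idP; rewrite !inE.
  case: (_ \in C); first by rewrite !mulr1 ec; lra.
  by rewrite !mulr0 expR0 addr0.
move=> dv.
have rr : 0 <= r * r - 1 by rewrite subr_ge0; nra.
have le_r : 1 + (r * r - 1) * fine (Q (past t @^-1` C)) <= r.
  (* With [exp c = r * r], an event of probability exactly [x] under [Q] has exponential moment [r].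
     The resulting bound [2 (1 - x) ln r - ln r] is the binary divergence [(1 - 2 x) ln r]. *)
  have rE : 1 + (r * r - 1) * x = r by rewrite /r; field; rewrite gt_eqF.
  by rewrite -[leRHS]rE lerD2l ler_wpM2l.
have Q0 : 0 <= fine (Q (past t @^-1` C)) by rewrite fine_ge0.
have ln_r : ln (1 + (r * r - 1) * fine (Q (past t @^-1` C))) <= ln r.
  by rewrite ler_ln ?posrE//; apply: ltr_pwDl => //; rewrite mulr_ge0.
have cP : c * (1 - x) <= c * fine (P (past t @^-1` C)) by rewrite ler_wpM2l.
apply: le_trans (binary_divergence_ge x x0 x2) _; rewrite -/r.
move: dv ln_r cP; rewrite /c; set Lr := ln r; set Lq := ln (1 + _).
set Pc := fine _; set tK := t%:R * K => dv ln_r cP.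
lra.
Qed.

End ChangeOfMeasure.

(* Pulling the arms of G for a fraction alpha of the rounds already prevents the
   total gap Sum D_i N_i from reaching alpha N Dbar. *)
Lemma good_arm_pulls_lt {R : realType} {n : nat} (D : 'I_n.+1 -> R)
    (G : pred 'I_n.+1) (cnt : 'I_n.+1 -> nat) (N : nat) (alpha DL Dbar : R) :
  (0 < N)%N -> 0 < alpha < 1 -> (\sum_i cnt i)%N = N ->
  (forall i, D i <= DL) -> (forall i, G i -> D i < Dbar - (1 - alpha) / alpha * DL) ->
  alpha * (N%:R * Dbar) <= \sum_i D i * (cnt i)%:R ->
  alpha * Dbar <= DL /\ (\sum_(i | G i) cnt i)%N%:R < alpha * N%:R.
Proof.
move=> N0 /andP[a0 a1] cntN DDL DG le_sum.
have NR0 : 0 < N%:R :> R by rewrite ltr0n.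
have NE : \sum_i (cnt i)%:R = N%:R :> R by rewrite -cntN natr_sum.
have aD : alpha * Dbar <= DL.
  rewrite -(ler_pM2l NR0); apply: le_trans (_ : \sum_i D i * (cnt i)%:R <= _).
    by rewrite mulrCA.
  by rewrite -NE mulr_suml; apply: ler_sum => i _; rewrite mulrC ler_wpM2l.
split=> //; set g := (\sum_(i | G i) cnt i)%N.
(* When some arm of [G] is pulled, its gap bound is strict, which makes the bound on the total gap
   strict. *)
have [->|g0] := eqVneq g 0%N; first by rewrite mulr_gt0.
have gR0 : 0 < g%:R :> R by rewrite ltr0n lt0n.
pose dg := Dbar - (1 - alpha) / alpha * DL.
have gE : \sum_(i | G i) (cnt i)%:R = g%:R :> R by rewrite /g natr_sum.
have ngE : \sum_(i | ~~ G i) (cnt i)%:R = N%:R - g%:R :> R.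
  by rewrite -NE [in RHS](bigID G)/= gE addrAC subrr add0r.
have lt_sum : \sum_i D i * (cnt i)%:R < g%:R * dg + (N%:R - g%:R) * DL.
  rewrite (bigID G)/= -ngE -gE !mulr_suml; apply: ltr_leD; last first.
    by apply: ler_sum => i _; rewrite mulrC ler_wpM2l.
  have [i Gi ci] : exists2 i, G i & (0 < cnt i)%N.
    move/eqP: g0; rewrite /g => h; apply: contrapT => nex; apply: h.
    apply: big1 => i Gi; apply/eqP; rewrite -leqn0 leqNgt; apply/negP => ci.
    by apply: nex; exists i.
  rewrite (bigD1 i)//= [ltRHS](bigD1 i)//=; apply: ltr_leD.
    by rewrite mulrC ltr_pM2l ?ltr0n//; exact: DG.
  by apply: ler_sum => j /andP[Gj _]; rewrite mulrC ler_wpM2l// ltW//; exact: DG.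
have dgE : alpha * dg = alpha * Dbar - (1 - alpha) * DL.
  by rewrite /dg mulrBr mulrA mulrCA divff ?gt_eqF// mulr1.
have h : alpha * (alpha * (N%:R * Dbar)) <
    g%:R * (alpha * Dbar - (1 - alpha) * DL) + alpha * ((N%:R - g%:R) * DL).
  have -> : g%:R * (alpha * Dbar - (1 - alpha) * DL) + alpha * ((N%:R - g%:R) * DL) =
      alpha * (g%:R * dg + (N%:R - g%:R) * DL)
    by rewrite -dgE [RHS]mulrDr; congr (_ + _); exact: mulrCA.
  rewrite ltr_pM2l//.
  exact: le_lt_trans le_sum lt_sum.
(* The inequality factors; the second factor is nonnegative by [aD], so the first must be
   negative. *)
have {h} : (g%:R - alpha * N%:R) * (DL - alpha * Dbar) < 0 by lra.
rewrite ltNge => /negP h; rewrite ltNge; apply/negP => ag; apply: h.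
by rewrite mulr_ge0// subr_ge0.
Qed.

(** * Comparison of the two instances *)

Theorem mainTheorem7
  (R : realType) (rho : {measure set R -> \bar R}) (Hrho : expfam_base rho)
  (n : nat)                                  (* L = n.+1 arms, arm 1 = ord0 *)
  (mu : 'I_n.+1 -> R) (th : 'I_n.+1 -> R)     (* instance nu *)
  (Hth : forall i, ef_mean rho (th i) = mu i)
  (Hsorted : forall i j : 'I_n.+1, (i <= j)%N -> mu j <= mu i)
  (Hgap : mu ord_max < mu ord0)
  (T TFE : nat) (HTFE : (0 < TFE)%N)
  (alpha beta : R) (Halpha : 0 < alpha < 1) (Hbeta : 0 < beta < 1)
  (Delta := fun i => mu ord0 - mu i)
  (Dbar := fine (save_star rho th T TFE) / TFE%:R)
  (Lg := [set i : 'I_n.+1 | Delta i < Dbar - (1 - alpha) / alpha * Delta ord_max])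
  (HLg : Lg !=set0)
  (xi1 : R) (Hxi1 : 0 < xi1)
  (th_low th_high : R)
  (Hlow : ef_mean rho th_low = (mu ord0 + mu ord_max - xi1) / 2)
  (Hhigh : ef_mean rho th_high = (mu ord0 + mu ord_max + xi1) / 2)
  (th1 := fun i : 'I_n.+1 => if i \in Lg then th_low else th_high)  (* nu^(1) *)
  (HLg_big : TFE%:R < (#|[pred i : 'I_n.+1 | i \in Lg]|)%:R * ln (T%:R) / ef_kl rho th_low th_high)
  (* the policy pi, realized on a probability space carrying its internal *)
  (* randomization U and the reward stacks X, under P (instance nu) and    *)
  (* P1 (instance nu^(1))                                                   *)
  (pi : R -> seq R -> 'I_n.+1) (Hpi : policy_measurable pi)
  (d : measure_display) (Omega : measurableType d)
  (U : Omega -> R) (X : 'I_n.+1 -> nat -> Omega -> R)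
  (P P1 : probability Omega R)
  (HP : bandit_model rho P th U X) (HP1 : bandit_model rho P1 th1 U X)
  (HU : forall A : set R, measurable A -> P (U @^-1` A) = P1 (U @^-1` A))
  (* pi is (alpha, beta)-probably saving on {nu, nu^(1)} *)
  (Hsave : probably_saving_at rho pi U X P th T TFE alpha beta)
  (Hsave1 : probably_saving_at rho pi U X P1 th1 T TFE alpha beta) :
  ((beta * ln (T%:R))%:E / (\big[Num.max/0]_(i < n.+1) ef_kl rho (th i) (th1 i))%:E
     <= (TFE%:R)%:E)%E.
Proof.
case: (HP) => mU mX indepP lawP; case: (HP1) => _ _ indepP1 lawP1.
pose Xm i : {mfun Omega >-> (R : measurableType _)} :=
  HB.pack (X i 0%N) (isMeasurableFun.Build _ _ _ _ _ (mX i 0%N)).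
(* All entries of a stack share one law, so entry 0 can represent it. *)
pose p i : probability (R : measurableType _) R := distribution P (Xm i).
pose q i : probability (R : measurableType _) R := distribution P1 (Xm i).
have XP i s (A : set R) : measurable A -> P (X i s @^-1` A) = p i A.
  by move=> mA; rewrite lawP// -(lawP i 0%N).
have XQ i s (A : set R) : measurable A -> P1 (X i s @^-1` A) = q i A.
  by move=> mA; rewrite lawP1// -(lawP1 i 0%N).
have pE i : has_ef_law rho (th i) (p i) by move=> A mA; rewrite -(XP i 0%N)// lawP.
have qE i : has_ef_law rho (th1 i) (q i) by move=> A mA; rewrite -(XQ i 0%N)// lawP1.
set K := \big[Num.max/0]_(i < n.+1) _.
have klK i : ef_kl rho (th i) (th1 i) <= K by exact: le_bigmax.
have K0 : 0 <= K by exact: bigmax_ge_id.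
have one_arm i (f : R -> R) c : measurable_fun setT f -> (forall x, 0 <= f x <= c) ->
    fine (\int[p i]_x (f x)%:E)%E <= K + ln (fine (\int[q i]_x (expR (f x))%:E)%E).
  move=> mf f0c; apply: le_trans (ef_donsker_varadhan rho Hrho _ _ _ _ f c (pE i) (qE i) mf f0c) _.
  by rewrite lerD2r.
(* If [ln T] were 0, the right side of [HLg_big] would vanish. *)
have lnT_gt0 : 0 < ln (T%:R : R).
  have lnT_ge0 : 0 <= ln (T%:R : R).
    by case: (T) => [|t]; [rewrite ln0 | rewrite ln_ge0// ler1n].
  rewrite lt_neqAle lnT_ge0 andbT eq_sym; apply/eqP => lnT0.
  by move: HLg_big; rewrite lnT0 mulr0 mul0r ltNge ler0n.
have T_gt0 : 0 < T%:R :> R.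
  by rewrite ltr0n lt0n; apply/eqP => T0; move: lnT_gt0; rewrite T0 ln0 ?ltxx.
have [[a0 a1] [b0 b1]] : (0 < alpha /\ alpha < 1) /\ (0 < beta /\ beta < 1).
  by move: Halpha Hbeta => /andP[-> ->] /andP[-> ->].
pose x : R := T%:R `^ (- beta) / (24%:R / 10%:R).
have TbE : T%:R `^ (- beta) = expR (- (beta * ln T%:R)) :> R.
  by rewrite /powR gt_eqF// mulNr.
have x0 : 0 < x by rewrite divr_gt0 ?powR_gt0.
have x24 : 24 / 10 * x = T%:R `^ (- beta) by rewrite /x mulrC divfK.
have x2 : x <= 1 / 2.
  have : T%:R `^ (- beta) <= 1 :> R.
    by rewrite TbE -[leRHS]expR0 ler_expR oppr_le0; exact: mulr_ge0 (ltW b0) (ltW lnT_gt0).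
  by move: x24; clear; move: (T%:R `^ _) x => y z; lra.
have x1 : x < 1 by apply: le_lt_trans x2 _; clear; lra.
have lnx : - ln (24 / 10 * x) = beta * ln T%:R by rewrite x24 TbE expRK opprK.
pose N w i := pulls pi (U w) (fun j s => X j s w) i TFE.
pose past w := (U w, rewards pi (U w) (fun i s => X i s w) TFE).
have NE w : N w = counts pi TFE (past w) by apply/funext => i; exact: pulls_counts.
have [mr _] := measurable_history pi Hpi U X mU mX TFE.
have mpast : measurable_fun setT past by exact: measurable_fun_pair.
have mevent (S : ('I_n.+1 -> nat) -> Prop) : measurable [set w | S (N w)].
  rewrite (_ : mkset _ = past @^-1` [set z | S (counts pi TFE z)]).
    by rewrite -[X in measurable X]setTI; apply: mpast => //; exact: measurable_counts.
  by apply/seteqP; split => w /=; rewrite NE.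
pose Lb : pred 'I_n.+1 := fun i => i \in Lg.
pose few (cnt : 'I_n.+1 -> nat) : Prop :=
  (\sum_(i | Lb i) cnt i)%N%:R < alpha * TFE%:R.
have best_mean : inst_mean rho th (best_arm rho th) = mu ord0.
  apply/le_anti/andP; split; first by rewrite /inst_mean Hth Hsorted.
  by rewrite -Hth; exact: inst_mean_le_best.
have gapE i : gap rho th i = Delta i by rewrite /gap best_mean /inst_mean Hth.
have Delta_ge0 i : 0 <= Delta i by rewrite subr_ge0 Hsorted.
have Delta_le i : Delta i <= Delta ord_max by rewrite lerD2l lerN2 Hsorted// leq_ord.
(* Were [save_star] infinite, [fine] would give [Dbar = 0]; the threshold in [Lg] would be at most 0
   and no gap could lie below it, against [HLg]. *)
have save_fin : save_star rho th T TFE \is a fin_num.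
  apply/negPn/negP => nfin; case: HLg => i /=; apply/negP.
  have -> : Dbar = 0.
    by rewrite /Dbar; move: nfin; case: (save_star _ _ _ _) => //= _; rewrite mul0r.
  rewrite -leNgt sub0r; apply: le_trans (Delta_ge0 i).
  by rewrite oppr_le0; apply: mulr_ge0 => //; rewrite divr_ge0 ?subr_ge0 ?ltW.
have nu_saving w : saving_event rho pi U X th T TFE alpha w ->
    alpha * Dbar <= Delta ord_max /\ few (N w).
  move=> /= sw; apply: (@good_arm_pulls_lt _ _ Delta) => //.
  - exact: sum_pulls.
  - by move=> i; rewrite /Lb inE.
  - have -> : TFE%:R * Dbar = fine (save_star rho th T TFE).
      by rewrite /Dbar mulrC divfK// gt_eqF// ltr0n.
    rewrite -lee_fin EFinM fineK//; apply: le_trans sw _.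
    apply: le_trans (save_hat_le rho th T _) _; rewrite lee_fin.
    by apply: ler_sum => i _; rewrite gapE.
have P_few : 1 - x <= fine (P [set w | few (N w)]).
  rewrite -lee_fin fineK ?fin_num_measure//; apply: le_trans Hsave _.
  apply: le_measure; rewrite ?inE//.
  - exact: (mevent (fun cnt => alpha%:E * save_star rho th T TFE <= save_hat rho th T cnt)%E).
  - by move=> w /nu_saving[].
(* The saving event has positive probability under [P] because [x < 1]. Any of its points yields
   [alpha * Dbar <= Delta ord_max], which keeps [ord_max] out of [Lg] and provides a high arm in
   [nu^(1)]. *)
have max_notin : ~~ Lb ord_max.
  have [w sw] : exists w, saving_event rho pi U X th T TFE alpha w.
    apply/not_existsP => ns; have : saving_event rho pi U X th T TFE alpha = set0.
      by apply/seteqP; split=> // w /ns.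
    move=> s0; move: Hsave; rewrite /probably_saving_at s0 measure0 lee_fin -/x.
    by rewrite leNgt subr_gt0 x1.
  have [aD _] := nu_saving _ sw.
  rewrite /Lb notin_setE /= => h; move: aD; apply/negP; rewrite -ltNge.
  have <- : alpha * (Delta ord_max + (1 - alpha) / alpha * Delta ord_max) = Delta ord_max.
    by move: (Delta _) => r; clear -a0; field; rewrite gt_eqF.
  by rewrite ltr_pM2l// -ltrBrDr.
have lo_hi : ef_mean rho th_low < ef_mean rho th_high by rewrite Hlow Hhigh; clear -Hxi1; lra.
have xiE : ef_mean rho th_high - ef_mean rho th_low = xi1 by rewrite Hlow Hhigh; clear -Hxi1; lra.
have ex_high : exists i, ~~ Lb i by exists ord_max.
have nu1_saving w : saving_event rho pi U X th1 T TFE alpha w -> ~ few (N w).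
  rewrite /saving_event /= => sw; apply/negP; rewrite -leNgt.
  move: sw; rewrite (two_level_save_star rho Lb _ _ T TFE lo_hi ex_high HLg_big).
  move=> /le_trans /(_ (two_level_save_hat rho Lb _ _ T lo_hi ex_high _)).
  by rewrite xiE -EFinM lee_fin mulrCA ler_pM2l.
have P1_few : fine (P1 [set w | few (N w)]) <= x.
  have : ((1 - x)%:E <= P1 (~` [set w | few (N w)]))%E.
    apply: le_trans Hsave1 _; apply: le_measure; rewrite ?inE//.
    - exact: (mevent (fun cnt => alpha%:E * save_star rho th1 T TFE <= save_hat rho th1 T cnt)%E).
    - exact: measurableC.
  rewrite probability_setC// -[P1 _]fineK ?fin_num_measure// -EFinB lee_fin.
  by rewrite lerD2l lerN2.
have pastE : past @^-1` [set z | few (counts pi TFE z)] = [set w | few (N w)].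
  by apply/seteqP; split=> w /=; rewrite NE.
have := bandit_event_divergence pi Hpi U X mU mX P P1 p q indepP indepP1 XP XQ HU K K0
  one_arm TFE [set z | few (counts pi TFE z)] x (measurable_counts pi Hpi TFE few) x0 x2.
rewrite -/past pastE => /(_ P_few P1_few); rewrite lnx => main.
have TFE0 : 0 < TFE%:R :> R by rewrite ltr0n.
have bl0 : 0 < beta * ln T%:R by rewrite mulr_gt0.
(* The bound [main] has a positive left side, which excludes [K = 0]; the extended quotient in the
   goal is then a real one. *)
have K_gt0 : 0 < K.
  rewrite lt_neqAle K0 andbT eq_sym; apply/eqP => Kz.
  by move: main; rewrite Kz mulr0 leNgt bl0.
by rewrite inver gt_eqF// -EFinM lee_fin ler_pdivrMr.
Qed.
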